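(* The Drinfeld double $D=D(\mathcal K^{\mathrm{cop}})$ is, as a $\Bbbk$-algebra, the algebra generated by elements $a,b,c,d,x,g$ such that $a,b,c,d$ satisfy the relations of $\mathcal K^{\mathrm{cop}}$, namely $ab=\xi ba$, $ac=\xi ca$, $cb=bc=0$, $cd=\xi dc$, $bd=\xi db$, $ad=da$, $ad=1$, $b^2=c^2=0$, $a^2c=b$, $a^4=1$; $x,g$ satisfy the relations of $(\mathcal A_4'')^{\mathrm{op\,cop}}$, namely $g^4=1$, $x^2=g^2-1$, $gx+xg=0$; and all together they satisfy $$ax+\xi xa=\sqrt2\,\xi(b+gc),\quad bx-\xi xb=\sqrt2\,\xi(a-gd),\quad cx+\xi xc=\sqrt2\,\xi(d-ga),\quad dx-\xi xd=\sqrt2\,\xi(c+gb),$$ $$ag=ga,\quad bg=-gb,\quad cg=-gc,\quad dg=gd.$$ Here $a,b,c,d$ stand for $\varepsilon\bowtie a,\varepsilon\bowtie b,\varepsilon\bowtie c,\varepsilon\bowtie d$ and $x,g$ stand for $\varphi(x)\bowtie1,\varphi(g)\bowtie1$.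
   Context: $\Bbbk$ is an algebraically closed field of characteristic zero, $\xi\in\Bbbk$ is a fixed primitive $4$-th root of unity and $\sqrt2$ a fixed square root of $2$. $\mathcal K$ is the $8$-dimensional Hopf algebra generated as an algebra by $a,b,c,d$ with relations $ab=\xi ba$, $ac=\xi ca$, $cb=bc=0$, $cd=\xi dc$, $bd=\xi db$, $ad=da$, $ad=1$, $b^2=c^2=0$, $a^2c=b$, $a^4=1$, with $\Delta(a)=a\otimes a+b\otimes c$, $\Delta(b)=a\otimes b+b\otimes d$, $\Delta(c)=c\otimes a+d\otimes c$, $\Delta(d)=c\otimes b+d\otimes d$, $\varepsilon(a)=\varepsilon(d)=1$, $\varepsilon(b)=\varepsilon(c)=0$, $\mathcal S(a)=d$, $\mathcal S(b)=\xi b$, $\mathcal S(c)=-\xi c$, $\mathcal S(d)=a$. A linear basis is $\{1,a,b,c,d,a^2,ab,ac\}$; its dual basis of $\mathcal K^*$ is denoted $\{1^*,a^*,b^*,c^*,d^*,(a^2)^*,(ab)^*,(ac)^*\}$. $\mathcal A_4''=\Bbbk\langle g,x\mid g^4-1=x^2-g^2+1=gx+xg=0\rangle$ with $\Delta(g)=g\otimes g$, $\Delta(x)=x\otimes g+1\otimes x$. There is a Hopf algebra isomorphism $\varphi:\mathcal A_4''\to\mathcal K^*$ given by $\varphi(g)=1^*+\xi^{-1}a^*+\xi d^*-(a^2)^*$ and $\varphi(x)=\sqrt2\,\xi(b^*+c^*+(ab)^*+(ac)^* )$, through which $\mathcal A_4''$ and $\mathcal K^*$ are identified. Thus $(\mathcal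 K^{\mathrm{cop}})^*=(\mathcal A_4'')^{\mathrm{op}}$. Drinfeld double: for a finite-dimensional Hopf algebra $H$, $D(H)=H^*\otimes H$ as a vector space (elements written $f\bowtie h$), with unit $\varepsilon\bowtie1$ and product $(f\bowtie h)(f'\bowtie k)=f(h_{(1)}\twoheadrightarrow f'_{(2)})\bowtie(h_{(2)}\twoheadleftarrow f'_{(1)})k$, where $h\twoheadrightarrow f=\langle f_{(3)}\mathcal S^{-1}(f_{(1)}),h\rangle f_{(2)}$ and $h\twoheadleftarrow f=\langle f,\mathcal S^{-1}(h_{(3)})h_{(1)}\rangle h_{(2)}$ for $h\in H$, $f\in H^*$. Here $H=\mathcal K^{\mathrm{cop}}$, i.e. $\mathcal K$ with opposite comultiplication. *)

(* Defs.v *)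
From HB Require Import structures.
From mathcomp Require Import all_boot all_order all_algebra all_field.

Set Implicit Arguments.
Unset Strict Implicit.
Unset Printing Implicit Defensive.

Import GRing.Theory.
Local Open Scope ring_scope.
Import VectorInternalTheory.

(* The tensor product of two finite-dimensional spaces, in coordinates: the
   entry (i, j) of t : tensor U V is the coefficient of e_i (x) e_j, where
   (e_i) are the vectors r2v (delta_mx 0 i) of the coordinate isomorphism
   r2v carried by a vectType. *)
Definition tensor (k : fieldType) (U V : vectType k) : Type :=
  'M[k]_(dim U, dim V).

HB.instance Definition _ (k : fieldType) (U V : vectType k) :=
  Vector.copy (tensor U V) 'M[k]_(dim U, dim V).

Definition tens (k : fieldType) (U V : vectType k) (u : U) (v : V) :
  tensor U V := (v2r u)^T *m v2r v.

(* For F bilinear, the value at t of the linear map u (x) v |-> F u v (see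
   tlift_tens). This is how Sweedler notation is rendered:
   \sw_(h1, h2 <- comul h) F h1 h2 is the usual sum of F h_(1) h_(2). *)
Definition tlift (k : fieldType) (U V : vectType k) (W : lmodType k)
    (t : tensor U V) (F : U -> V -> W) : W :=
  \sum_(i < dim U) \sum_(j < dim V)
    (t : 'M_(_, _)) i j *: F (r2v (delta_mx 0 i)) (r2v (delta_mx 0 j)).

Notation "\sw_ ( x , y <- t ) E" := (tlift t (fun x y => E))
  (at level 41, E at level 41, x name, y name, t at level 100,
   format "\sw_ ( x ,  y  <-  t )  E") : ring_scope.

Lemma tlift_tens (k : fieldType) (U V : vectType k) (W : lmodType k)
    (F : U -> V -> W) (u : U) (v : V) :
    (forall y, linear (F^~ y)) -> (forall x, linear (F x)) ->
  \sw_(x, y <- tens u v) F x y = F u v.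
Proof.
move=> linFl linFr.
have sumE (T : vectType k) (w : T) :
    w = \sum_(i < dim T) v2r w 0 i *: r2v (delta_mx 0 i).
  by rewrite -[LHS]v2rK {1}[v2r w]row_sum_delta linear_sum;
     apply: eq_bigr => i _; rewrite linearZ.
have linS (T : vectType k) (G : T -> W) : linear G -> forall n (c : 'I_n -> k) f,
    G (\sum_i c i *: f i) = \sum_i c i *: G (f i).
  move=> linG n c f; pose G' := GRing.isLinear.Build _ _ _ _ G linG.
  pose G'' : {linear T -> W} := HB.pack G G'.
  by rewrite -[G]/(G'' : _ -> _) linear_sum; apply: eq_bigr => i _; rewrite linearZ.
rewrite [in RHS](sumE _ u) (linS _ (F^~ v) (linFl v)).
apply: eq_bigr => i _.
rewrite [in RHS](sumE _ v) (linS _ _ (linFr _)) scaler_sumr.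
by apply: eq_bigr => j _; rewrite scalerA /tens mxE big_ord1 mxE.
Qed.

Lemma tlift_linear (k : fieldType) (U V : vectType k) (W : lmodType k)
    (F : U -> V -> W) : linear (fun t : tensor U V => tlift t F).
Proof.
move=> c s t; rewrite /tlift scaler_sumr -big_split; apply: eq_bigr => i _.
rewrite scaler_sumr -big_split; apply: eq_bigr => j _ /=.
by rewrite !mxE scalerDl scalerA.
Qed.

(* Structure maps on a finite-dimensional algebra; the axioms are in is_hopf. *)
Record hopfData (k : fieldType) := HopfData {
  hopf_alg :> falgType k;
  comul : 'Hom(hopf_alg, tensor hopf_alg hopf_alg);
  counit : 'Hom(hopf_alg, k^o);
  antipode : 'End(hopf_alg)
}.
Arguments comul {k} h.
Arguments counit {k} h.
Arguments antipode {k} h.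

Record is_hopf (k : fieldType) (H : hopfData k) : Prop := IsHopf {
  comulA : forall h : H,
    \sw_(x, y <- comul H h) \sw_(x1, x2 <- comul H x) tens x1 (tens x2 y) =
    \sw_(x, y <- comul H h) \sw_(y1, y2 <- comul H y) tens x (tens y1 y2);
  counitl : forall h : H, \sw_(x, y <- comul H h) (counit H x *: y) = h;
  counitr : forall h : H, \sw_(x, y <- comul H h) (counit H y *: x) = h;
  comul1 : comul H 1 = tens 1 1;
  comulM : forall h l : H, comul H (h * l) =
    \sw_(h1, h2 <- comul H h) \sw_(l1, l2 <- comul H l)
      tens (h1 * l1) (h2 * l2);
  counit1 : counit H 1 = 1;
  counitM : forall h l : H, counit H (h * l) = counit H h * counit H l;
  antipodel : forall h : H,
    \sw_(x, y <- comul H h) (antipode H x * y) = (counit H h)%:A;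
  antipoder : forall h : H,
    \sw_(x, y <- comul H h) (x * antipode H y) = (counit H h)%:A
}.

(* The antipode of H^cop is the inverse of the antipode of H. *)
Definition cop (k : fieldType) (H : hopfData k) : hopfData k :=
  {| hopf_alg := H;
     comul := linfun (fun h => \sw_(x, y <- comul H h) tens y x);
     counit := counit H;
     antipode := (antipode H)^-1%VF |}.

Section Dual.
Variables (k : fieldType) (H : hopfData k).

Definition dual : vectType k := 'Hom(H, k^o).

Definition dual_mul (f f' : dual) : dual :=
  linfun (fun h => \sw_(h1, h2 <- comul H h) (f h1 * f' h2)).

(* The convention is <f_(1), h><f_(2), l> = <f, h l>; see dual_comulE. *)
Definition dual_comul (f : dual) : tensor dual dual :=
  let e := vbasis {:H} in
  \sum_(i < \dim {:H}) \sum_(j < \dim {:H}) f (e`_i * e`_j) *: tens (linfun (coord e i : H -> k^o) : dual)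
                                        (linfun (coord e j : H -> k^o) : dual).

Definition dual_antipode : 'End(dual) :=
  linfun (fun f : dual => (f \o antipode H)%VF).

Lemma dual_comulE (f : dual) (h l : H) :
  \sw_(f1, f2 <- dual_comul f) (f1 h * f2 l : k^o) = f (h * l).
Proof.
pose ev (t : tensor dual dual) : k^o := \sw_(f1, f2 <- t) (f1 h * f2 l : k^o).
have evL : linear ev by exact: tlift_linear.
pose evI := GRing.isLinear.Build _ _ _ _ ev evL.
pose ev' : {linear tensor dual dual -> k^o} := HB.pack ev evI.
have eB (u : H) : u = \sum_i coord (vbasis {:H}) i u *: (vbasis {:H})`_i.
  by apply: coord_vbasis; rewrite memvf.
rewrite -[LHS]/(ev' _) /dual_comul linear_sum [in RHS](eB h) mulr_suml linear_sum.
apply: eq_bigr => i _; rewrite linear_sum [in RHS](eB l) mulr_sumr linear_sum.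
apply: eq_bigr => j _; rewrite linearZ /= /ev tlift_tens.
- rewrite !lfunE /= -scalerAl -scalerAr !linearZ /=.
  have kE (x y z : k) : z * y * x = x * (y * z) by rewrite mulrC (mulrC z).
  by rewrite [LHS]mulrC; exact: kE.
- by move=> y c s t; rewrite add_lfunE scale_lfunE mulrDl -scalerAl.
- move=> y c s t; rewrite add_lfunE scale_lfunE mulrDr.
  by congr (_ + _); exact: mulrCA.
Qed.

(* h ->> f = <f_(3) S^-1(f_(1)), h> f_(2), with S the antipode of H^* *)
Definition harpoonr (h : H) (f : dual) : dual :=
  \sw_(f1, f' <- dual_comul f) \sw_(f2, f3 <- dual_comul f')
    (dual_mul f3 ((dual_antipode^-1)%VF f1) h *: f2).

(* h <<- f = <f, S^-1(h_(3)) h_(1)> h_(2) *)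
Definition harpoonl (h : H) (f : dual) : H :=
  \sw_(h1, h' <- comul H h) \sw_(h2, h3 <- comul H h')
    (f ((antipode H)^-1%VF h3 * h1) *: h2).

(* D(H) has underlying space H^* (x) H, and f |><| h is tens f h. *)
Definition drinfeld : vectType k := tensor dual H.

Definition bowtie (f : dual) (h : H) : drinfeld := tens f h.

Definition drinfeld_one : drinfeld := bowtie (counit H) 1.

Definition drinfeld_mul (u v : drinfeld) : drinfeld :=
  \sw_(f, h <- u) \sw_(f', l <- v)
    \sw_(f1, f2 <- dual_comul f') \sw_(h1, h2 <- comul H h)
      bowtie (dual_mul f (harpoonr h1 f2)) (harpoonl h2 f1 * l).

End Dual.

(* A relation scheme says, in every algebra, which lists of elements satisfy
   the relations. A is the algebra generated by s subject to rels when s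
   satisfies them and (A, s) is universal for this. *)
Definition relations (k : fieldType) := forall B : algType k, seq B -> Prop.

Definition presented (k : fieldType) (rels : relations k)
    (A : algType k) (s : seq A) : Prop :=
  rels A s /\
  forall (B : algType k) (t : seq B), rels B t ->
    exists2 f : {lrmorphism A -> B}, map f s = t &
      forall f' : {lrmorphism A -> B}, map f' s = t -> f' =1 f.

(* The space D with the product mul and the unit one is, as an algebra, the
   algebra generated by s subject to rels; in particular mul is associative
   and bilinear, and one is its unit. *)
Definition presented_as (k : fieldType) (rels : relations k)
    (D : lmodType k) (mul : D -> D -> D) (one : D) (s : seq D) : Prop :=
  exists (A : algType k) (phi : {linear A -> D}) (s' : seq A),
    [/\ bijective phi, phi 1 = one, {morph phi : u v / u * v >-> mul u v},
        map phi s' = s & presented rels s'].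

Definition K_relations (k : fieldType) (xi : k) : relations k :=
  fun B s =>
  if s is [:: a; b; c; d] then
    [/\ [/\ a * b = xi *: (b * a), a * c = xi *: (c * a), c * b = 0 & b * c = 0],
        [/\ c * d = xi *: (d * c), b * d = xi *: (d * b), a * d = d * a & a * d = 1]
      & [/\ b ^+ 2 = 0, c ^+ 2 = 0, a ^+ 2 * c = b & a ^+ 4 = 1]]
  else False.

Definition K_basis (k : fieldType) (K : falgType k) (a b c d : K) : 8.-tuple K :=
  [tuple 1; a; b; c; d; a ^+ 2; a * b; a * c].

(* K is the 8-dimensional Hopf algebra with generators a, b, c, d. *)
Record is_K (k : fieldType) (xi : k) (K : hopfData k) (a b c d : K) : Prop := IsK {
  K_hopf : is_hopf K;
  K_presented : presented (K_relations xi) [:: a; b; c; d];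
  K_basisP : basis_of {:K} (K_basis a b c d);
  K_comul : [/\ comul K a = tens a a + tens b c, comul K b = tens a b + tens b d,
                comul K c = tens c a + tens d c & comul K d = tens c b + tens d d];
  K_counit : [/\ counit K a = 1, counit K d = 1, counit K b = 0 & counit K c = 0];
  K_antipode : [/\ antipode K a = d, antipode K b = xi *: b,
                   antipode K c = - (xi *: c) & antipode K d = a]
}.

Section DualBasis.
Variables (k : fieldType) (xi sqrt2 : k) (K : hopfData k) (a b c d : K).

(* The i-th element of the dual basis of
   {1, a, b, c, d, a ^+ 2, a * b, a * c}, numbered from 0. *)
Definition K_dual_basis (i : 'I_8) : dual K :=
  linfun (coord (K_basis a b c d) i : K -> k^o).

Local Notation e i := (K_dual_basis (inord i)).

(* phi(g) = 1^* + xi^-1 a^* + xi d^* - (a^2)^* *)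
Definition phi_g : dual K := e 0 + xi^-1 *: e 1 + xi *: e 4 - e 5.

(* phi(x) = sqrt2 xi (b^* + c^* + (ab)^* + (ac)^* ) *)
Definition phi_x : dual K := (sqrt2 * xi) *: (e 2 + e 3 + e 6 + e 7).

End DualBasis.

Definition drinfeld_relations (k : fieldType) (xi sqrt2 : k) : relations k :=
  fun B s =>
  if s is [:: a; b; c; d; x; g] then
    [/\ K_relations xi [:: a; b; c; d],
        [/\ g ^+ 4 = 1, x ^+ 2 = g ^+ 2 - 1 & g * x + x * g = 0],
        [/\ a * x + xi *: (x * a) = (sqrt2 * xi) *: (b + g * c),
            b * x - xi *: (x * b) = (sqrt2 * xi) *: (a - g * d),
            c * x + xi *: (x * c) = (sqrt2 * xi) *: (d - g * a)
          & d * x - xi *: (x * d) = (sqrt2 * xi) *: (c + g * b)]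
      & [/\ a * g = g * a, b * g = - (g * b), c * g = - (g * c) & d * g = g * d]]
  else False.

(* Main.v *)
Require Import Defs.
From HB Require Import structures.
From mathcomp Require Import all_boot all_order all_algebra all_field.

Set Implicit Arguments.
Unset Strict Implicit.
Unset Printing Implicit Defensive.

Import GRing.Theory VectorInternalTheory.
Local Open Scope ring_scope.

(** The product of the Drinfeld double of K^cop, written with the comultiplication
    of K itself, is
      (f |><| h)(f' |><| l) = sum f f'(S(h_1) ? h_3) |><| h_2 l,
    where f'(u ? v) is the functional y |-> f'(u y v) (bowtieM). In this form
    associativity is a regrouping of Sweedler indices that uses only that S
    reverses products and coproducts (antipodeM, comul_antipode), so that D(K^cop)
    is an algebra for every Hopf algebra K with bijective antipode. It contains K
    and its dual as subalgebras, is spanned by the products f h, and is governed by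
    one exchange rule, h f = sum f(S(h_1) ? h_3) h_2 (of_K_of_dual).

    For the 8-dimensional K, the functionals x and g are the matrix coefficients of
    a two-dimensional upper triangular representation h |-> [eps(h), x(h); 0, g(h)]
    (phi_mul). Hence g(u ? v) and x(u ? v) are explicit combinations of eps, x and
    g, and the exchange rule on the coefficients of the comultiplicative matrix
    [a, b; c, d] becomes the eight cross relations (straighten_x, straighten_g).

    Let B be an algebra with elements satisfying the relations. The presentation of
    K gives a morphism K -> B. The dual of K is also described by its generators:
    1^*, a^*, d^*, (a^2)^* are the spectral idempotents of g, and the other four
    vectors of the dual basis are, up to a scalar, the products of x with them.
    Therefore every functional is an explicit polynomial in x and g (dual_expand),
    and this polynomial can be evaluated wherever operators X and G satisfy the
    relations of x and g. The evaluation intertwines x with X and g with G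
    (dual_action_x, dual_action_g), so it gives a morphism from the dual of K to B.
    The map f h |-> (image of f)(image of h) is then multiplicative: it suffices to
    move a generator of K to the right through words in x and g, one letter at a
    time, and the cross relations, which hold on both sides, do this
    (drinfeld_lift_gens). The map is unique because a, b, c, d, x, g generate. *)

(** * Linearity side conditions *)

Section LinearClosure.
Variables (k : fieldType).
Implicit Types (T W : lmodType k) (U V : vectType k) (A : algType k).

Lemma lin_id W : linear (fun w : W => w).
Proof. by []. Qed.

Lemma lin_lfun T U V (g : 'Hom(U, V)) (f : T -> U) :
  linear f -> linear (fun w => g (f w)).
Proof. by move=> lf c u v; rewrite lf linearP. Qed.

Lemma lin_eval T U V (f : T -> 'Hom(U, V)) (u : U) :
  linear f -> linear (fun w => f w u).
Proof. by move=> lf c v w; rewrite lf add_lfunE scale_lfunE. Qed.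

Lemma lin_mull T A (f : T -> A) (z : A) :
  linear f -> linear (fun w => f w * z).
Proof. by move=> lf c v w; rewrite lf mulrDl scalerAl. Qed.

Lemma lin_mulr T A (f : T -> A) (z : A) :
  linear f -> linear (fun w => z * f w).
Proof. by move=> lf c v w; rewrite lf mulrDr scalerAr. Qed.

Lemma lin_scalel T W (f : T -> k^o) (z : W) :
  linear f -> linear (fun w => (f w : k) *: z).
Proof. by move=> lf c v w; rewrite lf scalerDl scalerA. Qed.

Lemma lin_scaler T W (f : T -> W) (z : k) :
  linear f -> linear (fun w => z *: f w).
Proof. by move=> lf c v w; rewrite lf scalerDr !scalerA mulrC. Qed.

Lemma lin_tensl T U V (f : T -> U) (z : V) :
  linear f -> linear (fun w => tens (f w) z).
Proof.
by move=> lf c v w; rewrite lf /tens !linearP mulmxDl scalemxAl.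
Qed.

Lemma lin_tensr T U V (f : T -> V) (z : U) :
  linear f -> linear (fun w => tens z (f w)).
Proof.
by move=> lf c v w; rewrite lf /tens linearP mulmxDr -scalemxAr.
Qed.

Lemma lin_sw T U V W (t : T -> tensor U V) (F : U -> V -> W) :
  linear t -> linear (fun w => tlift (t w) F).
Proof. by move=> lt c v w; rewrite lt tlift_linear. Qed.

Lemma lin_sw_body T U V W (t : tensor U V) (F : T -> U -> V -> W) :
  (forall x y, linear (fun w => F w x y)) ->
  linear (fun w => \sw_(x, y <- t) F w x y).
Proof.
move=> lF c v w; rewrite /tlift scaler_sumr -big_split; apply: eq_bigr => i _.
rewrite scaler_sumr -big_split; apply: eq_bigr => j _ /=.
by rewrite lF scalerDr !scalerA mulrC.
Qed.

Lemma lin_add T W (f g : T -> W) :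
  linear f -> linear g -> linear (fun w => f w + g w).
Proof. by move=> lf lg c v w; rewrite lf lg scalerDr addrACA. Qed.

End LinearClosure.

(** Sweedler sums behave well only for multilinear summands. multilin proves these
    side conditions by descending into the expression along the unique occurrence
    of the bound variable; lin_more is extended whenever new linear operations
    become available. *)
Ltac lin_more := fail.

Ltac lin1 := lazy beta; match goal with
  | |- forall _, _ => intro
  | |- linear _ => first
     [ exact (@lin_id _ _) | assumption | eassumption
     | apply: lin_mull | apply: lin_mulr | apply: lin_scaler | apply: lin_scalel
     | apply: lin_tensl | apply: lin_tensr | apply: lin_sw_body | apply: lin_sw
     | apply: lin_eval | apply: lin_lfun | apply: lin_add
     | lin_more ]
  end.
Ltac multilin := repeat lin1.

Lemma linZ (k : fieldType) (U W : lmodType k) (f : U -> W) (c : k) u :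
  linear f -> f (c *: u) = c *: f u.
Proof.
move=> lf; pose f' : {linear U -> W} := HB.pack f (GRing.isLinear.Build _ _ _ _ f lf).
by rewrite -[f]/(f' : _ -> _) linearZ.
Qed.

(** * Sweedler calculus *)

Section Sweedler.
Variables (k : fieldType).
Implicit Types (W : lmodType k) (U V : vectType k).

Lemma eq_sw U V W (t : tensor U V) (F G : U -> V -> W) :
  (forall x y, F x y = G x y) -> \sw_(x, y <- t) F x y = \sw_(x, y <- t) G x y.
Proof. by move=> FG; rewrite /tlift; do 2![apply: eq_bigr => ? _]; rewrite FG. Qed.

Lemma sw_map U V W W' (L : W -> W') (t : tensor U V) (F : U -> V -> W) :
  linear L -> L (tlift t F) = \sw_(x, y <- t) L (F x y).
Proof.
move=> lL; pose L' : {linear W -> W'} := HB.pack L (GRing.isLinear.Build _ _ _ _ L lL).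
rewrite -[L]/(L' : _ -> _) /tlift linear_sum; apply: eq_bigr => i _.
by rewrite linear_sum; apply: eq_bigr => j _; rewrite linearZ.
Qed.

Lemma sw_exchange U V U' V' W (s : tensor U V) (t : tensor U' V')
    (F : U -> V -> U' -> V' -> W) :
  \sw_(x, y <- s) \sw_(u, v <- t) F x y u v =
  \sw_(u, v <- t) \sw_(x, y <- s) F x y u v.
Proof.
rewrite /tlift; under eq_bigr => i _ do under eq_bigr => j _ do
  (rewrite scaler_sumr; under eq_bigr => p _ do rewrite scaler_sumr).
under [RHS]eq_bigr => i _ do under eq_bigr => j _ do
  (rewrite scaler_sumr; under eq_bigr => p _ do rewrite scaler_sumr).
rewrite pair_big [RHS]pair_big /=.
under eq_bigr => ? _ do rewrite pair_big /=.
under [RHS]eq_bigr => ? _ do rewrite pair_big /=.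
rewrite exchange_big /=; apply: eq_bigr => ? _; apply: eq_bigr => ? _.
by rewrite !scalerA mulrC.
Qed.

Lemma sw_sw U V U' V' W (t : tensor U V) (G : U -> V -> tensor U' V')
    (F : U' -> V' -> W) :
  tlift (\sw_(x, y <- t) G x y) F = \sw_(x, y <- t) tlift (G x y) F.
Proof. by rewrite (sw_map (L := fun s => tlift s F)) //; multilin. Qed.

Lemma sw_scaler U V W (c : k) (t : tensor U V) (F : U -> V -> W) :
  c *: (\sw_(x, y <- t) F x y) = \sw_(x, y <- t) (c *: F x y).
Proof. by rewrite (sw_map (L := fun w => c *: w)) //; multilin. Qed.

Lemma sw_tens U V W (F : U -> V -> W) u v :
  (forall y, linear (F^~ y)) -> (forall x, linear (F x)) ->
  \sw_(x, y <- tens u v) F x y = F u v.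
Proof. exact: tlift_tens. Qed.

Lemma swD U V W (s t : tensor U V) (F : U -> V -> W) :
  tlift (s + t) F = tlift s F + tlift t F.
Proof. by have := tlift_linear F 1 s t; rewrite !scale1r. Qed.

Lemma tens0l U V (v : V) : tens (0 : U) v = 0.
Proof. by rewrite /tens linear0 trmx0 mul0mx. Qed.

Lemma tens0r U V (u : U) : tens u (0 : V) = 0.
Proof. by rewrite /tens linear0 mulmx0. Qed.

Lemma tensZl U V r (u : U) (v : V) : tens (r *: u) v = r *: tens u v.
Proof. by rewrite (linZ (f := fun u => tens u v)) //; multilin. Qed.

Lemma tensZr U V r (u : U) (v : V) : tens u (r *: v) = r *: tens u v.
Proof. by rewrite (linZ (f := fun v => tens u v)) //; multilin. Qed.

Lemma tensNl U V (u : U) (v : V) : tens (- u) v = - tens u v.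
Proof. by rewrite -scaleN1r tensZl scaleN1r. Qed.

Lemma tensNr U V (u : U) (v : V) : tens u (- v) = - tens u v.
Proof. by rewrite -scaleN1r tensZr scaleN1r. Qed.

Lemma sw_id U V (t : tensor U V) : \sw_(x, y <- t) tens x y = t.
Proof.
rewrite /tlift [RHS]matrix_sum_delta; apply: eq_bigr => i _; apply: eq_bigr => j _.
congr (_ *: _); rewrite /tens !r2vK.
apply/matrixP => p q; rewrite !mxE big_ord1 !mxE.
by rewrite -natrM mulnb !eqxx.
Qed.

Lemma eq_tensor_lin U V W (L L' : tensor U V -> W) :
  linear L -> linear L' -> (forall x y, L (tens x y) = L' (tens x y)) -> L =1 L'.
Proof.
move=> lL lL' e t; rewrite -(sw_id t) !sw_map //; exact: eq_sw.
Qed.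

Lemma linfunE U V (f : U -> V) : linear f -> linfun f =1 f.
Proof.
move=> lf u; pose f' : {linear U -> V} := HB.pack f (GRing.isLinear.Build _ _ _ _ f lf).
by rewrite -[f]/(f' : _ -> _) lfunE.
Qed.

End Sweedler.

Lemma sw_exchange2 (k : fieldType) (U V U1 V1 U2 V2 U3 V3 : vectType k) (W : lmodType k)
    (s : tensor U V) (t : U -> V -> tensor U1 V1) (s' : tensor U2 V2)
    (t' : U2 -> V2 -> tensor U3 V3) (F : U -> V -> U1 -> V1 -> U2 -> V2 -> U3 -> V3 -> W) :
  \sw_(a, b <- s) \sw_(c, d <- t a b) \sw_(p, q <- s') \sw_(x, y <- t' p q) F a b c d p q x y =
  \sw_(p, q <- s') \sw_(x, y <- t' p q) \sw_(a, b <- s) \sw_(c, d <- t a b) F a b c d p q x y.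
Proof.
transitivity (\sw_(a, b <- s) \sw_(p, q <- s') \sw_(x, y <- t' p q) \sw_(c, d <- t a b)
  F a b c d p q x y).
  apply: eq_sw => a b; rewrite sw_exchange; apply: eq_sw => p q; exact: sw_exchange.
by rewrite sw_exchange; apply: eq_sw => p q; exact: sw_exchange.
Qed.

(** * Hopf algebras *)

Section Hopf.
Variables (k : fieldType) (K : hopfData k) (KP : is_hopf K).
Notation D := (comul K).
Notation S := (antipode K).
Notation eps := (counit K).
Implicit Types (W : lmodType k) (h l : K).

Lemma sw_coassoc W (F : K -> K -> K -> W) h :
  (forall y z, linear (fun x => F x y z)) ->
  (forall x z, linear (fun y => F x y z)) ->
  (forall x y, linear (fun z => F x y z)) ->
  \sw_(x, y <- D h) \sw_(x1, x2 <- D x) F x1 x2 y =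
  \sw_(x, y <- D h) \sw_(y1, y2 <- D y) F x y1 y2.
Proof.
move=> l1 l2 l3.
pose L (t : tensor K (tensor K K)) := \sw_(x, s <- t) \sw_(y, z <- s) F x y z.
have lL : linear L by rewrite /L; multilin.
have LE x y z : L (tens x (tens y z)) = F x y z.
  by rewrite /L sw_tens; [rewrite sw_tens | multilin..].
have := congr1 L (comulA KP h); rewrite !(sw_map _ _ lL) => e.
transitivity (\sw_(x, y <- D h) L (\sw_(x1, x2 <- D x) tens x1 (tens x2 y))).
  by apply: eq_sw => x y; rewrite (sw_map _ _ lL); apply: eq_sw => x1 x2; rewrite LE.
rewrite e; apply: eq_sw => x y; rewrite (sw_map _ _ lL).
by apply: eq_sw => x1 x2; rewrite LE.
Qed.

Lemma sw_counitl W (F : K -> W) h :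
  linear F -> \sw_(x, y <- D h) (eps x *: F y) = F h.
Proof.
move=> lF; rewrite -[in RHS](counitl KP h) (sw_map _ _ lF).
by apply: eq_sw => x y; rewrite linZ.
Qed.

Lemma sw_counitr W (F : K -> W) h :
  linear F -> \sw_(x, y <- D h) (eps y *: F x) = F h.
Proof.
move=> lF; rewrite -[in RHS](counitr KP h) (sw_map _ _ lF).
by apply: eq_sw => x y; rewrite linZ.
Qed.

Lemma sw_antipodel W (F : K -> W) h :
  linear F -> \sw_(x, y <- D h) F (S x * y) = eps h *: F 1.
Proof. by move=> lF; rewrite -linZ // -(antipodel KP) (sw_map _ _ lF). Qed.

Lemma sw_antipoder W (F : K -> W) h :
  linear F -> \sw_(x, y <- D h) F (x * S y) = eps h *: F 1.
Proof. by move=> lF; rewrite -linZ // -(antipoder KP) (sw_map _ _ lF). Qed.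

Lemma sw_comulM W (F : K -> K -> W) h l :
  (forall y, linear (F^~ y)) -> (forall x, linear (F x)) ->
  \sw_(x, y <- D (h * l)) F x y =
  \sw_(h1, h2 <- D h) \sw_(l1, l2 <- D l) F (h1 * l1) (h2 * l2).
Proof.
move=> l1 l2; rewrite (comulM KP) sw_sw; apply: eq_sw => h1 h2.
by rewrite sw_sw; apply: eq_sw => x y; rewrite sw_tens.
Qed.

Lemma sw_comul1 W (F : K -> K -> W) :
  (forall y, linear (F^~ y)) -> (forall x, linear (F x)) ->
  \sw_(x, y <- D 1) F x y = F 1 1.
Proof. by move=> l1 l2; rewrite (comul1 KP) sw_tens. Qed.

Lemma antipode1 : S 1 = 1.
Proof.
have := antipodel KP 1; rewrite sw_comul1; [|by multilin..].
by rewrite mulr1 (counit1 KP) scale1r.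
Qed.

(** The expression S(l_1) S(h_1) h_2 l_2 S(h_3 l_3) collapses from the left to
    S(h l), and from the right, where h_2 l_2 S(h_3 l_3) is an antipode law for the
    product, to S(l) S(h). *)
Lemma antipodeM h l : S (h * l) = S l * S h.
Proof.
pose M := \sw_(h1, h' <- D h) \sw_(h2, h3 <- D h')
  \sw_(l1, l' <- D l) \sw_(l2, l3 <- D l')
    (S l1 * (S h1 * h2) * l2 * S (h3 * l3)).
transitivity M.
  rewrite /M -sw_coassoc; [|by multilin..].
  transitivity (\sw_(u, h3 <- D h) (eps u *: S (h3 * l))).
    by rewrite sw_counitl; [|multilin].
  apply: eq_sw => u h3.
  under eq_sw => h1 h2.
    rewrite -sw_coassoc; [|by multilin..].
    over.
  rewrite sw_exchange /=.
  transitivity (\sw_(v, l3 <- D l) (eps v *: (eps u *: S (h3 * l3)))).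
    by rewrite sw_counitl; [|multilin].
  apply: eq_sw => v l3; rewrite sw_exchange.
  under eq_sw => l1 l2.
    rewrite (sw_antipodel (F := fun z => S l1 * z * l2 * S (h3 * l3))); last by multilin.
    rewrite mulr1.
    over.
  rewrite -sw_scaler (sw_antipodel (F := fun z => z * S (h3 * l3))); last by multilin.
  by rewrite mul1r !scalerA mulrC.
rewrite /M.
transitivity (\sw_(h1, h' <- D h) (eps h' *: (S l * S h1))).
  apply: eq_sw => h1 h'; rewrite sw_exchange.
  transitivity (\sw_(l1, l' <- D l) (eps l' *: (eps h' *: (S l1 * S h1)))).
    apply: eq_sw => l1 l'.
    transitivity (\sw_(z, w <- D (h' * l')) (S l1 * S h1 * (z * S w))).
      rewrite sw_comulM; [|by multilin..].
      by apply: eq_sw => h2 h3; apply: eq_sw => l2 l3; rewrite !mulrA.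
    rewrite (sw_antipoder (F := fun z => S l1 * S h1 * z)); last by multilin.
    by rewrite mulr1 (counitM KP) scalerA [in RHS]mulrC.
  by rewrite sw_counitr; [|multilin].
by rewrite sw_counitr; [|multilin].
Qed.

(** Both sides come from Delta(S(h_1)) (h_2 (x) h_3) (S(h_5) (x) S(h_4)): the last
    two factors cancel to leave Delta(S(h)), while the first two are
    Delta(S(h_1) h_2), which leaves S(h_2) (x) S(h_1). *)
Lemma comul_antipode h : D (S h) = \sw_(x, y <- D h) tens (S y) (S x).
Proof.
pose M := \sw_(h1, h' <- D h) \sw_(h2, h'' <- D h')
  \sw_(v, h5 <- D h'') \sw_(h3, h4 <- D v) \sw_(p, q <- D (S h1))
    tens (p * (h2 * S h5)) (q * (h3 * S h4)).
transitivity M.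
  transitivity (\sw_(h1, h' <- D h) (eps h' *: D (S h1))).
    by rewrite sw_counitr; [|multilin].
  apply: eq_sw => h1 h'.
  transitivity (\sw_(h2, h'' <- D h') \sw_(p, q <- D (S h1)) tens (p * (h2 * S h'')) q).
    rewrite sw_exchange -[in LHS](sw_id (D (S h1))) sw_scaler; apply: eq_sw => p q.
    rewrite (sw_antipoder (F := fun z => tens (p * z) q)); last by multilin.
    by rewrite mulr1.
  apply: eq_sw => h2 h''.
  rewrite -(sw_counitl (F := fun z => \sw_(p, q <- D (S h1)) tens (p * (h2 * S z)) q));
    last by multilin.
  apply: eq_sw => v h5; rewrite sw_exchange sw_scaler; apply: eq_sw => p q.
  rewrite (sw_antipoder (F := fun z => tens (p * (h2 * S h5)) (q * z))); last by multilin.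
  by rewrite mulr1.
rewrite /M.
(* Regroup the five factors of h as ((1, (2, 3)), (4, 5)). *)
transitivity (\sw_(h1, h' <- D h) \sw_(h2, h'' <- D h')
   \sw_(h3, v <- D h'') \sw_(h4, h5 <- D v) \sw_(p, q <- D (S h1))
    tens (p * (h2 * S h5)) (q * (h3 * S h4))).
  apply: eq_sw => h1 h'; apply: eq_sw => h2 h''.
  by rewrite -sw_coassoc //; multilin.
transitivity (\sw_(u, v <- D h) \sw_(h1, u' <- D u) \sw_(h2, h3 <- D u')
  \sw_(h4, h5 <- D v) \sw_(p, q <- D (S h1))
    tens (p * (h2 * S h5)) (q * (h3 * S h4))).
  rewrite sw_coassoc; [|by multilin..].
  apply: eq_sw => h1 h'; rewrite sw_coassoc //; multilin.
transitivity (\sw_(u, v <- D h) (eps u *: \sw_(h4, h5 <- D v) tens (S h5) (S h4))); last first.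
  by rewrite sw_counitl; [|multilin].
apply: eq_sw => u v.
under eq_sw => h1 u' do rewrite sw_exchange.
rewrite sw_exchange sw_scaler; apply: eq_sw => h4 h5.
transitivity (\sw_(h1, u' <- D u) \sw_(p, q <- D (S h1 * u')) tens (p * S h5) (q * S h4)).
  apply: eq_sw => h1 u'; rewrite sw_comulM; [|by multilin..].
  rewrite sw_exchange; apply: eq_sw => p q; apply: eq_sw => h2 h3.
  by rewrite !mulrA.
rewrite (sw_antipodel (F := fun z => \sw_(p, q <- D z) tens (p * S h5) (q * S h4)));
  last by multilin.
by rewrite sw_comul1 ?mul1r //; multilin.
Qed.
End Hopf.

(** * Functionals, translation and the dual product *)

Section Translate.
Variables (k : fieldType) (A : falgType k).
Implicit Types (f : 'Hom(A, k^o)).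

Definition translate (u v : A) f : 'Hom(A, k^o) := linfun (fun y => f (u * y * v)).

Lemma translateE u v f y : translate u v f y = f (u * y * v).
Proof. by rewrite linfunE //; multilin. Qed.

Lemma lin_translate1 (T : lmodType k) (g : T -> A) v f :
  linear g -> linear (fun w => translate (g w) v f).
Proof.
move=> lg c x y; apply/lfunP => z; rewrite add_lfunE scale_lfunE !translateE.
by rewrite lg !mulrDl linearD -!scalerAl linearZ.
Qed.

Lemma lin_translate2 (T : lmodType k) (g : T -> A) u f :
  linear g -> linear (fun w => translate u (g w) f).
Proof.
move=> lg c x y; apply/lfunP => z; rewrite add_lfunE scale_lfunE !translateE.
by rewrite lg !mulrDr linearD -!scalerAr linearZ.
Qed.

Lemma lin_translate3 (T : lmodType k) (g : T -> 'Hom(A, k^o)) u v :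
  linear g -> linear (fun w => translate u v (g w)).
Proof.
move=> lg c x y; apply/lfunP => z; rewrite add_lfunE scale_lfunE !translateE.
by rewrite lg add_lfunE scale_lfunE.
Qed.

Lemma translateM u v u' v' f : translate u v (translate u' v' f) = translate (u' * u) (v * v') f.
Proof. by apply/lfunP => y; rewrite !translateE !mulrA. Qed.

Lemma translate11 f : translate 1 1 f = f.
Proof. by apply/lfunP => y; rewrite translateE mul1r mulr1. Qed.

End Translate.

Section DualLinear.
Variables (k : fieldType) (H : hopfData k).
Implicit Types (f : dual H).

Lemma dual_mul_def f f' h :
  dual_mul f f' h = \sw_(h1, h2 <- comul H h) (f h1 * f' h2 : k^o).
Proof. by rewrite linfunE //; multilin. Qed.

Lemma lin_dual_mull (T : lmodType k) (g : T -> dual H) f :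
  linear g -> linear (fun w => dual_mul (g w) f).
Proof.
move=> lg c x y; apply/lfunP => z; rewrite add_lfunE scale_lfunE !dual_mul_def.
have l : linear (fun w => \sw_(h1, h2 <- comul H z) (g w h1 * f h2 : k^o)) by multilin.
exact: l.
Qed.

Lemma lin_dual_mulr (T : lmodType k) (g : T -> dual H) f :
  linear g -> linear (fun w => dual_mul f (g w)).
Proof.
move=> lg c x y; apply/lfunP => z; rewrite add_lfunE scale_lfunE !dual_mul_def.
have l : linear (fun w => \sw_(h1, h2 <- comul H z) (f h1 * g w h2 : k^o)) by multilin.
exact: l.
Qed.

Lemma lin_dual_comul (T : lmodType k) (g : T -> dual H) :
  linear g -> linear (fun w => dual_comul (g w)).
Proof.
move=> lg c x y; rewrite /dual_comul scaler_sumr -big_split; apply: eq_bigr => i _.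
rewrite scaler_sumr -big_split; apply: eq_bigr => j _ /=.
by rewrite lg add_lfunE scale_lfunE scalerDl scalerA.
Qed.

Lemma sw_dual_comul f h :
  \sw_(f1, f2 <- dual_comul f) (f1 h *: f2) = translate h 1 f.
Proof.
apply/lfunP => y; rewrite translateE mulr1 -dual_comulE.
rewrite (sw_map (L := fun g : dual H => g y)); last by multilin.
by apply: eq_sw => f1 f2; rewrite scale_lfunE.
Qed.

End DualLinear.

Ltac lin_more ::= first
  [ apply: lin_translate1 | apply: lin_translate2 | apply: lin_translate3
  | apply: lin_dual_mull | apply: lin_dual_mulr | apply: lin_dual_comul ].

(** * The Drinfeld double of the co-opposite Hopf algebra *)

Section Double.
Variables (k : fieldType) (K : hopfData k) (KP : is_hopf K).
Hypothesis Sinj : lker (antipode K) == 0%VS.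
Notation D := (comul K).
Notation S := (antipode K).
Notation eps := (counit K).
Notation H := (cop K).
Notation "f ** g" := (@dual_mul k H f g) (at level 40, left associativity).
Implicit Types (W : lmodType k) (h l m : K) (f : dual H) (u : drinfeld H).

Lemma counit_antipode h : eps (S h) = eps h.
Proof.
have le : linear (eps : K -> k^o) by move=> c x y; rewrite linearP.
rewrite -[RHS]mulr1 -(counit1 KP) -[RHS](sw_antipoder KP (F := eps)) //.
rewrite -(sw_counitl KP (F := fun z => eps (S z))); last by multilin.
by apply: eq_sw => x y; rewrite (counitM KP).
Qed.

Lemma sw_cop W (F : K -> K -> W) h :
  (forall y, linear (F^~ y)) -> (forall x, linear (F x)) ->
  \sw_(x, y <- comul H h) F x y = \sw_(x, y <- D h) F y x.
Proof.
move=> l1 l2; rewrite linfunE; last by multilin.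
by rewrite sw_sw; apply: eq_sw => x y; rewrite sw_tens.
Qed.

(** All computations are carried out with the comultiplication of K; passing to
    K^cop reverses the tensor factors. *)
Lemma dual_mulE f f' h :
  dual_mul f f' h = \sw_(x, y <- D h) (f y * f' x : k^o).
Proof. by rewrite dual_mul_def sw_cop //; multilin. Qed.

(** The double of K^cop is defined with the inverse of the antipode S^-1 of K^cop,
    which is S again: no inverse is left in the formulas below. *)
Lemma antipode_cop_inv : (antipode H)^-1%VF = S.
Proof.
have SK := lker0_lfunVK Sinj.
have kerV : lker (S^-1)%VF == 0%VS.
  by apply/lker0P => x y e; rewrite -(SK x) e SK.
by apply/lfunP => x; rewrite -{1}(lker0_lfunK Sinj x) (lker0_lfunK kerV).
Qed.

Lemma dual_antipodeV f : ((dual_antipode H)^-1)%VF f = (f \o S)%VF.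
Proof.
have aE g : dual_antipode H g = (g \o S^-1)%VF.
  by rewrite linfunE // => c x y; rewrite comp_lfunDl comp_lfunZl.
have ker0 : lker (dual_antipode H) == 0%VS.
  apply/lker0P => x y; rewrite !aE => e.
  by rewrite -(lker0_compfVK Sinj x) e lker0_compfVK.
by rewrite -[f in LHS](lker0_compfK Sinj) -aE lker0_lfunK.
Qed.

Lemma harpoonrE h f :
  harpoonr (h : H) f = \sw_(x, y <- D h) translate (S x) y f.
Proof.
apply/lfunP => z.
rewrite (sw_map (L := fun g : dual H => g z)); last by multilin.
rewrite [RHS](_ : _ = \sw_(x, y <- D h) \sw_(f1, f' <- dual_comul f)
    \sw_(f2, f3 <- dual_comul f') (f1 (S x) * (f2 z * f3 y) : k^o)); last first.
  rewrite (sw_map (L := fun g : dual H => g z)); last by multilin.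
  apply: eq_sw => x y; rewrite translateE -mulrA -dual_comulE.
  apply: eq_sw => f1 f'; rewrite -dual_comulE.
  by rewrite (sw_map (L := fun c => f1 (S x) * c : k^o)) //; multilin.
rewrite sw_exchange; apply: eq_sw => f1 f'.
rewrite (sw_map (L := fun g : dual H => g z)); last by multilin.
rewrite sw_exchange; apply: eq_sw => f2 f3.
rewrite scale_lfunE dual_mulE [LHS]mulrC (sw_map (L := fun c => f2 z * c : k^o)); last by multilin.
apply: eq_sw => x y; rewrite dual_antipodeV comp_lfunE.
by rewrite mulrA [RHS]mulrC.
Qed.

Lemma harpoonlE h f :
  harpoonl (h : H) f =
  \sw_(h1, h' <- D h) \sw_(h2, h3 <- D h') (f (S h1 * h3) *: h2).
Proof.
rewrite /harpoonl antipode_cop_inv.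
rewrite sw_cop; [|by multilin..].
rewrite -(sw_coassoc KP); [|by multilin..].
apply: eq_sw => x y.
by rewrite sw_cop //; multilin.
Qed.

(** Expanding the two harpoons gives f'(S(h_1) h_3 S(h_4) ? h_5) |><| h_2 l, in
    which h_3 S(h_4) cancels. *)
Lemma bowtieM f f' h l : drinfeld_mul (bowtie f h) (bowtie f' l) =
  \sw_(h1, h' <- D h) \sw_(h2, h3 <- D h')
    bowtie (dual_mul f (translate (S h1) h3 f')) (h2 * l).
Proof.
rewrite /drinfeld_mul.
rewrite sw_tens; [|by multilin..].
rewrite sw_tens; [|by multilin..].
rewrite sw_exchange sw_cop; [|by multilin..].
transitivity (\sw_(x, y <- D h) \sw_(x1, x' <- D x) \sw_(x2, x3 <- D x')
   \sw_(y1, y2 <- D y)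
   bowtie (dual_mul f (translate (S x1 * (x3 * S y1)) y2 f')) (x2 * l)).
  apply: eq_sw => x y.
  transitivity (\sw_(f1, f2 <- dual_comul f') \sw_(x1, x' <- D x)
     \sw_(x2, x3 <- D x') \sw_(y1, y2 <- D y)
     (f1 (S x1 * x3) *: bowtie (dual_mul f (translate (S y1) y2 f2)) (x2 * l))).
    apply: eq_sw => f1 f2; rewrite harpoonlE harpoonrE.
    rewrite (sw_map (L := fun z : H => bowtie _ (z * l))); last by multilin.
    apply: eq_sw => x1 x'.
    rewrite (sw_map (L := fun z : H => bowtie _ (z * l))); last by multilin.
    apply: eq_sw => x2 x3.
    rewrite (sw_map (L := fun g => bowtie (dual_mul f g) _)); last by multilin.
    apply: eq_sw => y1 y2.
    by rewrite (linZ (f := fun z : H => bowtie _ (z * l))); last by multilin.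
  rewrite sw_exchange; apply: eq_sw => x1 x'.
  rewrite sw_exchange; apply: eq_sw => x2 x3.
  rewrite sw_exchange; apply: eq_sw => y1 y2.
  rewrite mulrA -[in RHS](mulr1 y2) -(translateM (S y1) y2) -(sw_dual_comul (H := H)).
  rewrite (sw_map (L := fun g : dual H => bowtie (dual_mul f (translate (S y1) y2 g)) (x2 * l)));
    last by multilin.
  apply: eq_sw => f1 f2.
  by rewrite (linZ (f := fun g : dual H => bowtie (dual_mul f (translate (S y1) y2 g)) (x2 * l)));
    last by multilin.
(* Regroup until x3 and y1 are the two factors of one coproduct. *)
rewrite (sw_coassoc KP); [|by multilin..].
apply: eq_sw => x1 r.
rewrite (sw_coassoc KP); [|by multilin..].
apply: eq_sw => x2 t.
rewrite -(sw_coassoc KP); [|by multilin..].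
rewrite -[RHS](sw_counitl KP (F := fun z => bowtie (dual_mul f (translate (S x1) z f')) (x2 * l)));
  last by multilin.
apply: eq_sw => v y2.
rewrite (sw_antipoder KP (F := fun z => bowtie (dual_mul f (translate (S x1 * z) y2 f')) (x2 * l)));
  last by multilin.
by rewrite mulr1.
Qed.

(** The two bracketings of a triple product in the double produce these groupings of
    a fivefold coproduct; both reduce to the right-nested one. *)
Lemma sw_regroup5 W (F : K -> K -> K -> K -> K -> W) h :
  (forall b c d e, linear (fun a => F a b c d e)) ->
  (forall a c d e, linear (fun b => F a b c d e)) ->
  (forall a b d e, linear (fun c => F a b c d e)) ->
  (forall a b c e, linear (fun d => F a b c d e)) ->
  (forall a b c d, linear (fun e => F a b c d e)) ->
  \sw_(h1, h' <- D h) \sw_(h'', h5 <- D h') \sw_(h2, s <- D h'') \sw_(h3, h4 <- D s)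
    F h1 h2 h3 h4 h5 =
  \sw_(u, h' <- D h) \sw_(h3, v <- D h') \sw_(h1, h2 <- D u) \sw_(h4, h5 <- D v)
    F h1 h2 h3 h4 h5.
Proof.
move=> l1 l2 l3 l4 l5.
transitivity (\sw_(h1, h' <- D h) \sw_(h2, h'' <- D h') \sw_(h3, v <- D h'')
  \sw_(h4, h5 <- D v) F h1 h2 h3 h4 h5).
  apply: eq_sw => h1 h'; rewrite (sw_coassoc KP); [|by multilin..].
  by apply: eq_sw => h2 h''; rewrite (sw_coassoc KP); [|by multilin..].
rewrite -(sw_coassoc KP); [|by multilin..].
apply: eq_sw => u h'; rewrite sw_exchange.
by apply: eq_sw => h3 v.
Qed.

Lemma dual_mulA f f' f'' :
  dual_mul f (dual_mul f' f'') = dual_mul (dual_mul f f') f''.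
Proof.
apply/lfunP => h; rewrite !dual_mulE.
transitivity (\sw_(x, y <- D h) \sw_(x1, x2 <- D x) (f y * (f' x2 * f'' x1) : k^o)).
  apply: eq_sw => x y; rewrite dual_mulE.
  by rewrite (sw_map (L := fun c => f y * c : k^o)) //; multilin.
rewrite (sw_coassoc KP); [|by multilin..].
apply: eq_sw => x y; rewrite dual_mulE.
rewrite (sw_map (L := fun c => c * f'' x : k^o)); last by multilin.
by apply: eq_sw => y1 y2; rewrite mulrA.
Qed.

Lemma dual_mul1f f : dual_mul (eps : dual H) f = f.
Proof.
apply/lfunP => h; rewrite dual_mulE.
by rewrite -(sw_counitr KP (F := fun z => f z : k^o)); multilin.
Qed.

Lemma dual_mulf1 f : dual_mul f (eps : dual H) = f.
Proof.
apply/lfunP => h; rewrite dual_mulE.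
rewrite -(sw_counitl KP (F := fun z => f z : k^o)); last by multilin.
by apply: eq_sw => x y; exact: mulrC.
Qed.

(** This compatibility of the exchange rule with the product of functionals is
    where comul_antipode enters. *)
Lemma translate_dual_mul h l f f' :
  translate (S h) l (f ** f') =
  \sw_(x, y <- D h) \sw_(z, w <- D l)
    translate (S x) w f ** translate (S y) z f'.
Proof.
apply/lfunP => t; rewrite translateE dual_mulE.
rewrite (sw_comulM KP); [|by multilin..].
rewrite (sw_comulM KP); [|by multilin..].
rewrite (comul_antipode KP) sw_sw.
rewrite (sw_map (L := fun g : dual H => g t)); last by multilin.
apply: eq_sw => x y; rewrite sw_tens; [|by multilin..].
rewrite (sw_map (L := fun g : dual H => g t)); last by multilin.
rewrite sw_exchange; apply: eq_sw => z w.
by rewrite dual_mulE; apply: eq_sw => t1 t2; rewrite !translateE.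
Qed.

Lemma lin_drinfeld_mull (T : lmodType k) (g : T -> drinfeld H) u :
  linear g -> linear (fun w => drinfeld_mul (g w) u).
Proof. by move=> lg; rewrite /drinfeld_mul; multilin. Qed.

Lemma lin_drinfeld_mulr (T : lmodType k) (g : T -> drinfeld H) u :
  linear g -> linear (fun w => drinfeld_mul u (g w)).
Proof. by move=> lg; rewrite /drinfeld_mul; multilin. Qed.

(** On both sides h splits into five factors and m into three; antipodeM turns
    S(h_2 m_1) into S(m_1) S(h_2), and sw_regroup5 matches the groupings. *)
Lemma bowtieA f f' f'' h m l :
  drinfeld_mul (drinfeld_mul (bowtie f h) (bowtie f' m)) (bowtie f'' l) =
  drinfeld_mul (bowtie f h) (drinfeld_mul (bowtie f' m) (bowtie f'' l)).
Proof.
pose F (m1 m2 m3 h1 h2 h3 h4 h5 : K) : drinfeld H := bowtie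
  (f ** (translate (S h1) h5 f' ** translate (S m1 * S h2) (h4 * m3) f''))
  (h3 * (m2 * l)).
transitivity (\sw_(h1, h' <- D h) \sw_(h'', h5 <- D h')
   \sw_(h2, s <- D h'') \sw_(h3, h4 <- D s)
   \sw_(m1, m' <- D m) \sw_(m2, m3 <- D m') F m1 m2 m3 h1 h2 h3 h4 h5).
  rewrite bowtieM.
  rewrite (sw_map (L := fun u : drinfeld H => drinfeld_mul u _)); last exact: lin_drinfeld_mull.
  apply: eq_sw => h1 h'.
  rewrite (sw_map (L := fun u : drinfeld H => drinfeld_mul u _)); last exact: lin_drinfeld_mull.
  apply: eq_sw => h'' h5; rewrite bowtieM.
  rewrite (sw_comulM KP); [|by multilin..].
  apply: eq_sw => h2 s.
  under eq_sw => m1 m'.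
    rewrite (sw_comulM KP); [|by multilin..].
    over.
  rewrite sw_exchange; apply: eq_sw => h3 h4.
  apply: eq_sw => m1 m'; apply: eq_sw => m2 m3.
  by rewrite /F (antipodeM KP) -dual_mulA [in RHS]mulrA.
rewrite (sw_regroup5 (F := fun h1 h2 h3 h4 h5 => \sw_(m1, m' <- D m) \sw_(m2, m3 <- D m')
   F m1 m2 m3 h1 h2 h3 h4 h5)); [|rewrite /F; by multilin..].
transitivity (\sw_(m1, m' <- D m) \sw_(m2, m3 <- D m') \sw_(u, h' <- D h)
   \sw_(h3, v <- D h') \sw_(h1, h2 <- D u) \sw_(h4, h5 <- D v) F m1 m2 m3 h1 h2 h3 h4 h5).
  rewrite [RHS]sw_exchange2; apply: eq_sw => u h'; apply: eq_sw => h3 v.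
  exact: sw_exchange2.
rewrite bowtieM.
rewrite (sw_map (L := fun u : drinfeld H => drinfeld_mul _ u)); last exact: lin_drinfeld_mulr.
apply: eq_sw => m1 m'.
rewrite (sw_map (L := fun u : drinfeld H => drinfeld_mul _ u)); last exact: lin_drinfeld_mulr.
apply: eq_sw => m2 m3.
rewrite bowtieM; apply: eq_sw => u h'; apply: eq_sw => h3 v.
rewrite translate_dual_mul (sw_map (L := fun g : dual H => bowtie (f ** g) _)); last by multilin.
apply: eq_sw => h1 h2.
rewrite (sw_map (L := fun g : dual H => bowtie (f ** g) _)); last by multilin.
by apply: eq_sw => h4 h5; rewrite translateM.
Qed.

Lemma drinfeld_mulA : associative (@drinfeld_mul k H).
Proof.
move=> u v w.
apply/esym; move: u; apply: eq_tensor_lin => [||f h].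
- exact/lin_drinfeld_mull/lin_drinfeld_mull.
- exact: lin_drinfeld_mull.
move: v; apply: eq_tensor_lin => [||f' m].
- exact/lin_drinfeld_mull/lin_drinfeld_mulr.
- exact/lin_drinfeld_mulr/lin_drinfeld_mull.
move: w; apply: eq_tensor_lin => [||f'' l].
- exact/lin_drinfeld_mulr.
- exact/lin_drinfeld_mulr/lin_drinfeld_mulr.
exact: bowtieA.
Qed.

Lemma bowtie1M f f' l :
  drinfeld_mul (bowtie f (1 : H)) (bowtie f' l) = bowtie (f ** f') l.
Proof.
rewrite bowtieM (sw_comul1 KP); [|by multilin..].
by rewrite (sw_comul1 KP) ?(antipode1 KP) ?translate11 ?mul1r //; multilin.
Qed.

Lemma translate_counit a b : translate a b (eps : dual H) = (eps a * eps b) *: (eps : dual H).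
Proof.
apply/lfunP => y; rewrite translateE scale_lfunE !(counitM KP).
by rewrite -mulrA [eps y * _]mulrC mulrA.
Qed.

Lemma bowtieM1 f h l :
  drinfeld_mul (bowtie f (h : H)) (bowtie (eps : dual H) l) = bowtie f (h * l : H).
Proof.
rewrite bowtieM.
transitivity (\sw_(h1, h' <- D h) (eps h1 *: bowtie f (h' * l : H))); last first.
  by rewrite (sw_counitl KP (F := fun z => bowtie f (z * l : H))); multilin.
apply: eq_sw => h1 h'.
transitivity (\sw_(h2, h3 <- D h') (eps h3 *: (eps h1 *: bowtie f (h2 * l : H)))); last first.
  by rewrite (sw_counitr KP (F := fun z => eps h1 *: bowtie f (z * l : H))); multilin.
apply: eq_sw => h2 h3.
rewrite translate_counit counit_antipode.
rewrite (linZ (f := fun g : dual H => bowtie (f ** g) _)); last by multilin.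
by rewrite dual_mulf1 scalerA mulrC.
Qed.

Lemma bowtie_straighten f h :
  drinfeld_mul (bowtie (eps : dual H) (h : H)) (bowtie f 1) =
  \sw_(h1, h' <- D h) \sw_(h2, h3 <- D h') bowtie (translate (S h1) h3 f : dual H) (h2 : H).
Proof.
rewrite bowtieM; apply: eq_sw => h1 h'; apply: eq_sw => h2 h3.
by rewrite mulr1 dual_mul1f.
Qed.

Lemma drinfeld_mul1u : left_id (drinfeld_one H) (@drinfeld_mul k H).
Proof.
apply: eq_tensor_lin => [||f h]; [exact: lin_drinfeld_mulr | by [] |].
by rewrite bowtie1M dual_mul1f.
Qed.

Lemma drinfeld_mulu1 : right_id (drinfeld_one H) (@drinfeld_mul k H).
Proof.
apply: eq_tensor_lin => [||f h]; [exact: lin_drinfeld_mull | by [] |].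
by rewrite bowtieM1 mulr1.
Qed.

Lemma drinfeld_mulDl : left_distributive (@drinfeld_mul k H) +%R.
Proof.
move=> u v w; have := lin_drinfeld_mull w (fun c x y => erefl (c *: x + y : drinfeld H)) 1 u v.
by rewrite !scale1r.
Qed.

Lemma drinfeld_mulDr : right_distributive (@drinfeld_mul k H) +%R.
Proof.
move=> w u v; have := lin_drinfeld_mulr w (fun c x y => erefl (c *: x + y : drinfeld H)) 1 u v.
by rewrite !scale1r.
Qed.

Lemma drinfeld_scalel c u v : c *: drinfeld_mul u v = drinfeld_mul (c *: u) v.
Proof. by rewrite (linZ (f := fun u => drinfeld_mul u v)) //; exact: lin_drinfeld_mull. Qed.

Lemma drinfeld_scaler c u v : c *: drinfeld_mul u v = drinfeld_mul u (c *: v).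
Proof. by rewrite (linZ (f := fun v => drinfeld_mul u v)) //; exact: lin_drinfeld_mulr. Qed.

(** The functional f |><| h |-> f(1) eps(h) takes the value 1 at the unit. *)
Lemma drinfeld_one_neq0 : drinfeld_one H != 0.
Proof.
apply/eqP => e; have := oner_neq0 k; rewrite -(counit1 KP).
pose L (u : drinfeld H) : k^o := \sw_(f, h <- u) (f 1 *: eps h).
have lL : linear L by rewrite /L; multilin.
have : L (drinfeld_one H) = eps 1.
  rewrite /L sw_tens; [|by multilin..].
  by rewrite (counit1 KP) scale1r.
move=> <-; rewrite e.
by have := linZ 0 0 lL; rewrite !scale0r => ->; rewrite eqxx.
Qed.

End Double.

(** The proofs are parameters of the carrier so that its ring structure, which
    depends on them, can be declared canonically. *)
Definition drinfeld_alg (k : fieldType) (K : hopfData k) (KP : is_hopf K)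
  (Sinj : lker (antipode K) == 0%VS) : Type := drinfeld (cop K).

Section DoubleAlgebra.
Variables (k : fieldType) (K : hopfData k) (KP : is_hopf K).
Variable (Sinj : lker (antipode K) == 0%VS).
Notation H := (cop K).
Notation A := (drinfeld_alg KP Sinj).

HB.instance Definition _ := Vector.copy A (drinfeld (cop K)).
HB.instance Definition _ := GRing.Zmodule_isNzRing.Build A
  (drinfeld_mulA KP Sinj) (drinfeld_mul1u KP Sinj) (drinfeld_mulu1 KP Sinj)
  (@drinfeld_mulDl k K) (@drinfeld_mulDr k K) (drinfeld_one_neq0 KP).
HB.instance Definition _ := GRing.Lmodule_isLalgebra.Build k A
  (@drinfeld_scalel k K).
HB.instance Definition _ := GRing.Lalgebra_isAlgebra.Build k A
  (@drinfeld_scaler k K).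

End DoubleAlgebra.

Section Generators.
Variables (k : fieldType) (K : hopfData k) (KP : is_hopf K).
Variable (Sinj : lker (antipode K) == 0%VS).
Notation H := (cop K).
Notation A := (drinfeld_alg KP Sinj).
Notation eps := (counit K).
Notation "f ** g" := (@dual_mul k H f g) (at level 40, left associativity).

Definition of_K (h : K) : A := bowtie (eps : dual H) (h : H).
Definition of_dual (f : dual H) : A := bowtie f (1 : H).

Lemma of_K_linear : linear of_K.
Proof. by rewrite /of_K; multilin. Qed.

HB.instance Definition _ := GRing.isLinear.Build k K A _ of_K of_K_linear.

Lemma of_KM : monoid_morphism of_K.
Proof. by split=> // h l; apply/esym/(bowtieM1 KP Sinj). Qed.

HB.instance Definition _ := GRing.isMonoidMorphism.Build K A of_K of_KM.

Lemma of_dual_linear : linear of_dual.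
Proof. by rewrite /of_dual; multilin. Qed.

HB.instance Definition _ := GRing.isLinear.Build k (dual H) A _ of_dual of_dual_linear.

Lemma of_dual1 : of_dual (eps : dual H) = 1.
Proof. by []. Qed.

Lemma of_dualM f g : of_dual (f ** g) = of_dual f * of_dual g.
Proof. exact/esym/(bowtie1M KP Sinj). Qed.

Lemma of_dual_of_K f h : of_dual f * of_K h = bowtie f (h : H) :> drinfeld H.
Proof.
rewrite -[LHS]/(drinfeld_mul (of_dual f) (of_K h)) /of_dual /of_K.
by rewrite (bowtie1M KP Sinj) (dual_mulf1 KP).
Qed.

(** The exchange rule, from which every relation between the two halves follows. *)
Lemma of_K_of_dual h f :
  of_K h * of_dual f =
  \sw_(h1, h' <- comul K h) \sw_(h2, h3 <- comul K h')
    (of_dual (translate (antipode K h1) h3 f) * of_K h2).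
Proof.
apply: etrans (bowtie_straighten KP Sinj f h) _.
apply: eq_sw => h1 h'; apply: eq_sw => h2 h3.
by rewrite -of_dual_of_K.
Qed.

Lemma drinfeld_alg_ind (P : A -> Prop) :
  (forall c u v, P u -> P v -> P (c *: u + v)) ->
  (forall f h, P (of_dual f * of_K h)) -> forall u, P u.
Proof.
move=> PL Pfh u.
have P0 : P 0 by rewrite -[0](addNr (of_dual 0 * of_K 0)) -scaleN1r; apply: PL.
have Ps n (F : 'I_n -> A) : (forall i, P (F i)) -> P (\sum_i F i).
  by move=> PF; elim/big_rec: _ => // i v _ Pv; rewrite -[F i]scale1r; apply: PL.
have Pz (c : k) v : P v -> P (c *: v) by move=> Pv; rewrite -[_ *: _]addr0; apply: PL.
rewrite -(sw_id (u : drinfeld H)); apply: (Ps) => i; apply: (Ps) => j; apply: Pz.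
by have := Pfh (r2v (delta_mx 0 i)) (r2v (delta_mx 0 j)); rewrite of_dual_of_K.
Qed.

End Generators.
(** * Upper triangular matrices and spectral projections *)

Section UpperTriangular.
Variable k : fieldType.
Definition upper2 (p q r : k) : 'M[k]_2 :=
  \matrix_(i, j) if i == 0 then (if j == 0 then p else q) else (if j == 0 then 0 else r).

Lemma upper2M p q r p' q' r' :
  upper2 p q r * upper2 p' q' r' = upper2 (p * p') (p * q' + q * r') (r * r').
Proof.
apply/matrixP => i j; rewrite !mxE !big_ord_recl big_ord0 !mxE /=.
by case: ifP => _; case: ifP => _; rewrite ?(mulr0, mul0r, addr0, add0r).
Qed.

Lemma upper2Z t p q r : t *: upper2 p q r = upper2 (t * p) (t * q) (t * r).
Proof.
by apply/matrixP => i j; rewrite !mxE; case: ifP => _; case: ifP => _; rewrite ?mulr0.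
Qed.

Lemma upper2_1 : 1 = upper2 1 0 1.
Proof. by apply/matrixP => i j; rewrite !mxE; case: i => -[|[|]] //; case: j => -[|[|]]. Qed.

Lemma upper2_0 : 0 = upper2 0 0 0.
Proof. by apply/matrixP => i j; rewrite !mxE; do 2!case: ifP => _. Qed.

Lemma upper2_inj p q r p' q' r' : upper2 p q r = upper2 p' q' r' -> [/\ p = p', q = q' & r = r'].
Proof.
by move=> /matrixP u; move: (u 0 0) (u 0 1) (u 1 1); rewrite !mxE.
Qed.

End UpperTriangular.

Section Fourier.
Variables (k : fieldType) (V : lmodType k).
Implicit Types (t : k) (v : V) (T : V -> V).

(** For an operator T with T^4 = 1 and t^4 = 1, this is the projection of v to the
    eigenspace of T for the eigenvalue t^-1. *)
Definition fourier T t v : V :=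
  4%:R^-1 *: (v + t *: T v + t ^+ 2 *: T (T v) + t ^+ 3 *: T (T (T v))).

Lemma fourier_eigen T t v : linear T -> T (T (T (T v))) = v -> t ^+ 4 = 1 ->
  t *: T (fourier T t v) = fourier T t v.
Proof.
move=> lT T4 t4; rewrite /fourier.
have TZ r u : T (r *: u) = r *: T u by apply: linZ.
have TD u w : T (u + w) = T u + T w by have := lT 1 u w; rewrite !scale1r.
rewrite !(TZ, TD) T4 scalerA mulrC -scalerA; congr (_ *: _).
by rewrite !scalerDr !scalerA -expr2 -!exprS t4 scale1r addrC !addrA.
Qed.

Lemma fourier_sum T xi v : xi * xi = -1 -> 4%:R != 0 :> k ->
  fourier T 1 v + fourier T xi v + fourier T (- xi) v + fourier T (-1) v = v.
Proof.
move=> xi2 n4.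
have add4 (p q r u p' q' r' u' : V) : (p + q + r + u) + (p' + q' + r' + u') =
    (p + p') + (q + q') + (r + r') + (u + u').
  by rewrite addrACA [p + q + r + _]addrACA [p + q + _]addrACA.
rewrite /fourier -!scalerDr (add4 v) (add4 (v + v)) (add4 (v + v + v)) -!scalerDl.
have sq : xi ^+ 2 = -1 by rewrite expr2.
have c2 : 1 ^+ 2 + xi ^+ 2 + (- xi) ^+ 2 + (-1) ^+ 2 = 0 :> k.
  by rewrite !sqrrN !expr1n sq subrK subrr.
have c3 : 1 ^+ 3 + xi ^+ 3 + (- xi) ^+ 3 + (-1) ^+ 3 = 0 :> k.
  by rewrite !(exprS _ 2) !sqrrN !expr1n sq !mulrN !mulr1 !opprK subrK subrr.
rewrite c2 c3 addrK subrr !scale0r !addr0.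
have -> : v + v + v + v = 4%:R *: v by rewrite scaler_nat !mulrS mulr0n addr0 !addrA.
by rewrite scalerA mulVf ?scale1r.
Qed.
End Fourier.

(** * The 8-dimensional Hopf algebra *)

Section EightDimensional.
Variables (k : fieldType) (xi : k).
Hypothesis xi_prim : 4.-primitive_root xi.
Variables (K : hopfData k) (a b c d : K).
Variables (sqrt2 : k) (sqrt2E : sqrt2 ^+ 2 = 2%:R).
Hypothesis KP : is_K xi a b c d.
Hypothesis four_neq0 : 4%:R != 0 :> k.
Notation D := (comul K).
Notation S := (antipode K).
Notation eps := (counit K).
Notation H := (cop K).
Notation e := (K_basis a b c d).
Notation x := (phi_x xi sqrt2 a b c d).
Notation g := (phi_g xi a b c d).
Notation s := (sqrt2 * xi).
(* The product of the dual of K^cop is opposite to convolution on K. *)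
Notation "f ** h" := (@dual_mul k H f h) (at level 40, left associativity).
Notation gL := (fun phi : dual H => g ** phi).
Notation xL := (fun phi : dual H => x ** phi).
Let HP := K_hopf KP.
Let rels := (K_presented KP).1.
Implicit Types (f phi : dual H).

Lemma xi_sqr : xi * xi = -1.
Proof.
have x4 := prim_expr_order xi_prim.
have := prim_order_dvd xi_prim 2; rewrite /= => /esym/negbT x2.
have /eqP : (xi ^+ 2 - 1) * (xi ^+ 2 + 1) = 0.
  by rewrite mulrDr mulrBl mulr1 mul1r -exprD x4 addrA subrK subrr.
by rewrite mulf_eq0 subr_eq0 (negPf x2) /= addr_eq0 => /eqP.
Qed.

Lemma xiV : xi^-1 = - xi.
Proof.
have x0 : xi != 0.
  apply/eqP => x0; have := xi_sqr; rewrite x0 mul0r => /esym/eqP.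
  by rewrite oppr_eq0 oner_eq0.
by apply: (mulfI x0); rewrite divff // mulrN xi_sqr opprK.
Qed.

Lemma eq_on_K_basis (W : lmodType k) (f g : K -> W) : linear f -> linear g ->
  (forall i, (i < 8)%N -> f e`_i = g e`_i) -> f =1 g.
Proof.
move=> lf lg fg h.
pose f' : {linear K -> W} := HB.pack f (GRing.isLinear.Build _ _ _ _ f lf).
pose g' : {linear K -> W} := HB.pack g (GRing.isLinear.Build _ _ _ _ g lg).
rewrite (coord_basis (K_basisP KP) (memvf h)) -[f]/(f' : _ -> _) -[g]/(g' : _ -> _).
rewrite !linear_sum; apply: eq_bigr => i _; rewrite !linearZ; congr (_ *: _); exact: fg.
Qed.

Lemma K_ind (P : K -> Prop) :
  (forall r u v, P u -> P v -> P (r *: u + v)) ->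
  P 1 -> P a -> P b -> P c -> P d -> (forall u v, P u -> P v -> P (u * v)) ->
  forall h, P h.
Proof.
move=> PL P1 Pa Pb Pc Pd PM h.
have P0 : P 0 by rewrite -[0](addNr (1 : K)) -scaleN1r; apply: PL.
rewrite (coord_basis (K_basisP KP) (memvf h)).
elim/big_rec: _ => // i x _ Px; apply: PL => //.
by case: i => -[|[|[|[|[|[|[|[|]]]]]]]] //= _; try rewrite expr2; try apply: PM.
Qed.

Lemma K_swap : [/\ b * a = - (xi *: (a * b)), c * a = - (xi *: (a * c)), b * c = 0 & c * b = 0].
Proof.
have [[ab ac cb bc] _ _] := rels.
by rewrite ab ac !scalerA xi_sqr !scaleN1r !opprK.
Qed.

Lemma sw_comul_gens (W : lmodType k) (F : K -> K -> W) :
  (forall y, linear (F^~ y)) -> (forall x, linear (F x)) ->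
  [/\ \sw_(x, y <- D a) F x y = F a a + F b c,
      \sw_(x, y <- D b) F x y = F a b + F b d,
      \sw_(x, y <- D c) F x y = F c a + F d c &
      \sw_(x, y <- D d) F x y = F c b + F d d].
Proof. by move=> l1 l2; have [-> -> -> ->] := K_comul KP; rewrite !swD !sw_tens. Qed.

(** Together with the matrix [a, b; c, d], these comultiplications describe the
    whole coalgebra: a 2 x 2 matrix block, and the coefficients of the two
    triangular matrices [a^2, ab; 0, 1] and [1, ac; 0, a^2]. *)
Lemma comul_products :
  [/\ D (a ^+ 2) = tens (a ^+ 2) (a ^+ 2),
      D (a * b) = tens (a ^+ 2) (a * b) + tens (a * b) 1 &
      D (a * c) = tens (a * c) (a ^+ 2) + tens 1 (a * c)].
Proof.
have [ba ca bc cb] := K_swap.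
have [_ [cd bd ad ad1] [bb cc _ _]] := rels.
rewrite expr2 in bb; rewrite expr2 in cc.
have [Da Db Dc Dd] := K_comul KP.
split; rewrite ?expr2 (comulM HP) ?Da ?Db ?Dc !(swD, sw_tens); try by multilin.
- rewrite ba ca bb tens0l addr0 tensNl tensNr tensZl tensZr opprK scalerA xi_sqr.
  by rewrite scaleN1r addrK.
- by rewrite ad1 bb tens0l cb tens0r !addr0.
- by rewrite ad1 bc tens0l cc tens0r !addr0.
Qed.

(** S has order dividing 4, since S^4 is multiplicative and fixes the generators. *)
Lemma antipode_inj : lker S == 0%VS.
Proof.
have [Sa Sb Sc Sd] := K_antipode KP.
have S4 : (fun h => S (S (S (S h)))) =1 id.
  apply: K_ind.
  - by move=> r u v /= Pu Pv; rewrite !linearP /= Pu Pv.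
  - by rewrite !(antipode1 HP).
  - by rewrite Sa Sd Sa Sd.
  - have Sbr r : S (r *: b) = (xi * r) *: b by rewrite linearZ /= Sb scalerA mulrC.
    by rewrite -[in LHS](scale1r b) !Sbr mulr1 xi_sqr mulrN1 mulrN xi_sqr opprK scale1r.
  - have Scr r : S (r *: c) = (- xi * r) *: c by rewrite linearZ /= Sc -scaleNr scalerA mulrC.
    rewrite -[in LHS](scale1r c) !Scr mulr1 [- xi * - xi]mulrNN xi_sqr.
    by rewrite mulrN1 opprK mulNr xi_sqr opprK scale1r.
  - by rewrite Sd Sa Sd Sa.
  - by move=> u v /= Pu Pv; rewrite !(antipodeM HP) Pu Pv.
by apply/lker0P => x y Sxy; rewrite -(S4 x) Sxy S4.
Qed.

Lemma s_sqr : s * s = - 2%:R.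
Proof. by rewrite mulrACA xi_sqr -expr2 sqrt2E mulrN1. Qed.

Lemma K_dual_basisE m n : (m < 8)%N -> (n < 8)%N ->
  K_dual_basis a b c d (inord m) e`_n = (m == n)%:R.
Proof.
move=> m8 n8; rewrite /K_dual_basis lfunE /=.
have -> : n = Ordinal n8 by [].
rewrite coord_free ?(basis_free (K_basisP KP)) //.
by rewrite -val_eqE /= inordK // eq_sym.
Qed.

Lemma phi_gE :
  [/\ g 1 = 1, g a = - xi, g b = 0 & g c = 0] /\
  [/\ g d = xi, g (a ^+ 2) = - 1, g (a * b) = 0 & g (a * c) = 0].
Proof.
have gE n : (n < 8)%N -> g e`_n = (0 == n)%:R - xi *: ((1 == n)%:R : k^o)
    + xi *: ((4 == n)%:R : k^o) - (5 == n)%:R.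
  move=> n8; rewrite /phi_g xiV !(add_lfunE, opp_lfunE, scale_lfunE) !K_dual_basisE //.
  by rewrite scaleNr.
have cE (t : k) : t *: (1 : k^o) = t by exact: mulr1.
by do 2!split;
  [ have := gE 0 isT | have := gE 1 isT | have := gE 2 isT | have := gE 3 isT
  | have := gE 4 isT | have := gE 5 isT | have := gE 6 isT | have := gE 7 isT ];
  rewrite /= ?cE ?scaler0 ?(subr0, addr0, sub0r, add0r).
Qed.

Lemma phi_xE :
  [/\ x 1 = 0, x a = 0, x b = s & x c = s] /\
  [/\ x d = 0, x (a ^+ 2) = 0, x (a * b) = s & x (a * c) = s].
Proof.
have xE n : (n < 8)%N -> x e`_n = s *: ((2 == n)%:R + (3 == n)%:R
    + (6 == n)%:R + (7 == n)%:R : k^o).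
  by move=> n8; rewrite /phi_x !(add_lfunE, scale_lfunE) !K_dual_basisE.
have cE (t : k) : t *: (1 : k^o) = t by exact: mulr1.
by do 2!split;
  [ have := xE 0 isT | have := xE 1 isT | have := xE 2 isT | have := xE 3 isT
  | have := xE 4 isT | have := xE 5 isT | have := xE 6 isT | have := xE 7 isT ];
  rewrite /= ?(subr0, addr0, sub0r, add0r) ?cE ?scaler0.
Qed.

(** The matrices [eps(h), x(h); 0, g(h)] satisfy the relations of K at the
    generators. By the presentation of K they extend to a representation, whose
    entries are compared with eps, x and g on the basis. *)
Lemma phi_mul h l :
  x (h * l) = eps h * x l + x h * g l :> k /\ g (h * l) = g h * g l :> k.
Proof.
have [[g1 ga gb gc] [gd ga2 gab gac]] := phi_gE.
have [[x1 xa xb xc] [xd xa2 xab xac]] := phi_xE.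
have [ea ed eb ec] := K_counit KP.
have [_] := K_presented KP.
move=> /(_ _ [:: upper2 1 0 (- xi); upper2 0 s 0; upper2 0 s 0; upper2 1 0 xi]) [].
  rewrite /K_relations ?expr2 ?[_ ^+ 4](exprM _ 2 2) ?expr2 ?upper2M ?upper2Z ?upper2_1 ?upper2_0.
  rewrite ?(mulr0, mul0r, addr0, add0r, mulr1, mul1r, mulrN, mulNr, xi_sqr, opprK, mulNr).
  by rewrite mulrCA xi_sqr mulrN1 opprK [xi * s]mulrC; split; split.
move=> chi [chia chib chic chid] _.
have chiM u v : chi (u * v) = chi u * chi v by exact: rmorphM.
have chiE : (chi : K -> _) =1 (fun h => upper2 (eps h) (x h) (g h)).
  apply: eq_on_K_basis.
  - by move=> r u v; rewrite linearP.
  - move=> r u v; rewrite !linearP upper2Z; apply/matrixP => i j; rewrite !mxE.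
    by case: ifP => _; case: ifP => _; rewrite ?addr0.
  case=> [|[|[|[|[|[|[|[|]]]]]]]] //= _.
  - by rewrite rmorph1 x1 g1 (counit1 HP) upper2_1.
  - by rewrite chia ea xa ga.
  - by rewrite chib eb xb gb.
  - by rewrite chic ec xc gc.
  - by rewrite chid ed xd gd.
  - rewrite expr2 chiM chia upper2M -expr2 xa2 ga2 expr2 (counitM HP) ea.
    by rewrite !mulr0 mulr1 mul0r addr0 mulrNN xi_sqr.
  - by rewrite chiM chia chib upper2M xab gab (counitM HP) ea eb !mulr0 mul1r addr0.
  - by rewrite chiM chia chic upper2M xac gac (counitM HP) ea ec !mulr0 mul1r addr0.
have := chiM h l; rewrite !chiE upper2M => /upper2_inj[_ -> ->]; by split.
Qed.

Lemma dual_eq8 (f f' : dual H) :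
  [/\ f 1 = f' 1, f a = f' a, f b = f' b & f c = f' c] ->
  [/\ f d = f' d, f (a ^+ 2) = f' (a ^+ 2), f (a * b) = f' (a * b) & f (a * c) = f' (a * c)] ->
  f = f'.
Proof.
case=> f1 fa fb fc [fd fa2 fab fac]; apply/lfunP; apply: eq_on_K_basis.
- by move=> r u v; rewrite linearP.
- by move=> r u v; rewrite linearP.
by case=> [|[|[|[|[|[|[|[|]]]]]]]].
Qed.

Lemma dual_mul_val f phi :
  [/\ (f ** phi) 1 = f 1 * phi 1, (f ** phi) a = f a * phi a + f c * phi b,
      (f ** phi) b = f b * phi a + f d * phi b &
      (f ** phi) c = f a * phi c + f c * phi d] /\
  [/\ (f ** phi) d = f b * phi c + f d * phi d,
      (f ** phi) (a ^+ 2) = f (a ^+ 2) * phi (a ^+ 2),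
      (f ** phi) (a * b) = f (a * b) * phi (a ^+ 2) + f 1 * phi (a * b) &
      (f ** phi) (a * c) = f (a ^+ 2) * phi (a * c) + f (a * c) * phi 1].
Proof.
have [Da2 Dab Dac] := comul_products.
have [||Sa Sb Sc Sd] := sw_comul_gens (F := fun y z => f z * phi y : k^o); [by multilin..|].
rewrite !dual_mulE Sa Sb Sc Sd Da2 Dab Dac !swD (sw_comul1 HP); [|by multilin..].
by rewrite !sw_tens; multilin.
Qed.

(** Left multiplication by g is diagonal in the dual basis. *)
Lemma mul_gE :
  ((forall phi, ((g ** phi) 1 = phi 1)%R) * (forall phi, ((g ** phi) a = - xi * phi a)%R) *
   (forall phi, ((g ** phi) b = xi * phi b)%R) * (forall phi, ((g ** phi) c = - xi * phi c)%R) *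
   (forall phi, ((g ** phi) d = xi * phi d)%R) *
   (forall phi, ((g ** phi) (a ^+ 2) = - phi (a ^+ 2))%R) *
   (forall phi, ((g ** phi) (a * b) = phi (a * b))%R) *
   (forall phi, ((g ** phi) (a * c) = - phi (a * c))%R))%type.
Proof.
have [[g1 ga gb gc] [gd ga2 gab gac]] := phi_gE.
by refine (_, _, _, _, _, _, _, _) => phi;
  have [[v1 va vb vc] [vd va2 vab vac]] := dual_mul_val g phi;
  rewrite ?(v1, va, vb, vc) ?(vd, va2, vab, vac) ?(g1, ga, gb, gc) ?(gd, ga2, gab, gac)
    ?(mul0r, addr0, add0r, mul1r, mulN1r).
Qed.

Lemma mul_xE :
  ((forall phi, ((x ** phi) 1 = 0)%R) * (forall phi, ((x ** phi) a = s * phi b)%R) *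
   (forall phi, ((x ** phi) b = s * phi a)%R) * (forall phi, ((x ** phi) c = s * phi d)%R) *
   (forall phi, ((x ** phi) d = s * phi c)%R) * (forall phi, ((x ** phi) (a ^+ 2) = 0)%R) *
   (forall phi, ((x ** phi) (a * b) = s * phi (a ^+ 2))%R) *
   (forall phi, ((x ** phi) (a * c) = s * phi 1)%R))%type.
Proof.
have [[x1 xa xb xc] [xd xa2 xab xac]] := phi_xE.
by refine (_, _, _, _, _, _, _, _) => phi;
  have [[v1 va vb vc] [vd va2 vab vac]] := dual_mul_val x phi;
  rewrite ?(v1, va, vb, vc) ?(vd, va2, vab, vac) ?(x1, xa, xb, xc) ?(xd, xa2, xab, xac)
    ?(mul0r, addr0, add0r, mul1r, mulN1r).
Qed.

Lemma s_neq0 : s != 0.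
Proof.
apply/eqP => s0; have := s_sqr; rewrite s0 mul0r => /eqP.
rewrite eq_sym oppr_eq0 => /eqP two; case/eqP: four_neq0.
by have := natrM k 2 2; rewrite two mul0r => ->.
Qed.

(** * Functionals as polynomials in x and g *)

Section Combination.
Variables (V : lmodType k) (X G : V -> V).

(** The value at v of the functional phi, written as a polynomial in x and g, when
    x and g act by X and G. The projections for the eigenvalues 1, - xi, xi, - 1 of
    G stand for 1^*, a^*, d^*, (a^2)^*, and s^-1 X times them for (ac)^*, b^*, c^*,
    (ab)^*. The same formula serves for the dual itself (dual_expand) and for any
    algebra in which the relations of x and g hold (dual_lift). *)
Definition dual_action (v : V) (phi : dual H) : V :=
  let F t := fourier G t v in
  (phi 1 *: F 1 + phi a *: F xi + phi d *: F (- xi) + phi (a ^+ 2) *: F (- 1)) +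
  s^-1 *: X (phi (a * c) *: F 1 + phi b *: F xi + phi c *: F (- xi) + phi (a * b) *: F (- 1)).

Hypotheses (lX : linear X) (lG : linear G).

Lemma dual_action_linear v : linear (dual_action v).
Proof.
have lXf (f : dual H -> V) : linear f -> linear (fun w => X (f w)).
  by move=> lf r u w; rewrite lf lX.
rewrite /dual_action; apply: lin_add; first by multilin.
by apply/lin_scaler/lXf; multilin.
Qed.

Lemma dual_action_counit v : dual_action v (eps : dual H) = v.
Proof.
have [ea ed eb ec] := K_counit KP.
rewrite /dual_action (counit1 HP) expr2 !(counitM HP) ea eb ec ed.
rewrite !mulr0 !scale0r !addr0 mulr1 !scale1r.
have -> : X 0 = 0 by have := linZ 0 0 lX; rewrite !scale0r.
by rewrite scaler0 addr0 fourier_sum // xi_sqr.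
Qed.

Variable v : V.
Hypotheses (G4 : forall u, G (G (G (G u))) = u) (XX : forall u, X (X u) = G (G u) - u).
Hypothesis (GX : forall u, G (X u) = - X (G u)).
Let F t := fourier G t v.

Lemma fourier_eigens :
  [/\ G (F 1) = F 1, G (F xi) = - xi *: F xi, G (F (- xi)) = xi *: F (- xi) &
      G (F (- 1)) = - F (- 1)].
Proof.
have x4 : xi ^+ 4 = 1 by exact: prim_expr_order xi_prim.
have eig t : t ^+ 4 = 1 -> t *: G (F t) = F t by move=> t4; apply: fourier_eigen.
split.
- by rewrite -[in RHS]eig ?expr1n ?scale1r.
- by rewrite -[in RHS]eig // scalerA mulNr xi_sqr opprK scale1r.
- by rewrite -[in RHS]eig ?(exprM _ 2 2) ?sqrrN -?exprM // scalerA mulrN xi_sqr opprK scale1r.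
- by rewrite -[in RHS]eig ?(exprM _ 2 2) ?sqrrN ?expr1n // scaleN1r opprK.
Qed.

(** Since G X = - X G, the vector X w has the eigenvalue opposite to that of w; this
    matches the signs in mul_gE. *)
Lemma dual_action_g phi : dual_action v (g ** phi) = G (dual_action v phi).
Proof.
rewrite /dual_action !mul_gE.
have GD u w : G (u + w) = G u + G w by have := lG 1 u w; rewrite !scale1r.
have GZ t u : G (t *: u) = t *: G u by apply: linZ.
rewrite -/(F 1) -/(F xi) -/(F (- xi)) -/(F (- 1)).
move: fourier_eigens; generalize F => E [G1 Ga Gd Ga2].
rewrite GD [in RHS]GZ GX !GD !GZ G1 Ga Gd Ga2.
congr (_ + _ *: _).
  by rewrite !scalerA ![_ * phi _]mulrC scalerN scaleNr.
have XN u : X (- u) = - X u by rewrite -scaleN1r (linZ _ _ lX) scaleN1r.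
rewrite -XN; congr (X _).
by rewrite !opprD !scalerA !scalerN !opprK -!scaleNr ![_ * phi _]mulrC !mulrN !opprK.
Qed.

(** X^2 = G^2 - 1 vanishes on the eigenvalues 1 and - 1 of G, and is - 2 = s^2 on
    the eigenvalues xi and - xi. *)
Lemma dual_action_x phi : dual_action v (x ** phi) = X (dual_action v phi).
Proof.
rewrite /dual_action !mul_xE.
have XD u w : X (u + w) = X u + X w by have := lX 1 u w; rewrite !scale1r.
have XZ t u : X (t *: u) = t *: X u by apply: linZ.
have GD u w : G (u + w) = G u + G w by have := lG 1 u w; rewrite !scale1r.
have GZ t u : G (t *: u) = t *: G u by apply: linZ.
rewrite -/(F 1) -/(F xi) -/(F (- xi)) -/(F (- 1)).
move: fourier_eigens; generalize F => E [G1 Ga Gd Ga2].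
rewrite [RHS]XD [in RHS](XZ s^-1) XX !(GD, GZ, G1, Ga, Gd, Ga2).
move: s_sqr s_neq0; generalize s => z zz z0.
transitivity ((z * phi b) *: E xi + (z * phi c) *: E (- xi) +
  X (phi 1 *: E 1 + phi a *: E xi + phi d *: E (- xi) + phi (a ^+ 2) *: E (-1))).
  rewrite !scale0r add0r addr0; congr (_ + _).
  by rewrite -!scalerA -!scalerDr XZ scalerA mulVf ?scale1r.
rewrite addrC; congr (_ + _).
have Eneg (u : V) : - xi *: (- xi *: u) = - u /\ xi *: (xi *: u) = - u.
  by rewrite !scalerA mulrNN xi_sqr scaleN1r.
have GN u : G (- u) = - G u by rewrite -scaleN1r GZ scaleN1r.
have cancel4 (p q r u : V) : p - q - r + u - (p + q + r + u) = (- 2%:R) *: (q + r).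
  rewrite scaleNr scaler_nat mulr2n !opprD [LHS]addrACA [p - q - r + _]addrACA.
  by rewrite [p - q + _]addrACA !subrr add0r addr0 addrACA.
rewrite (Eneg _).1 (Eneg _).2 GN Ga2 opprK !scalerN cancel4 -zz.
by rewrite scalerA mulrA mulVf // mul1r scalerDr !scalerA.
Qed.

End Combination.

Lemma mul_gggg phi : g ** (g ** (g ** (g ** phi))) = phi.
Proof.
have x2 (z : k) : xi * (xi * z) = - z by rewrite mulrA xi_sqr mulN1r.
by apply: dual_eq8; rewrite !mul_gE ?(mulNr, mulrN, opprK, x2).
Qed.

Lemma mul_xx phi : x ** (x ** phi) = g ** (g ** phi) - phi.
Proof.
have x2 (z : k) : xi * (xi * z) = - z by rewrite mulrA xi_sqr mulN1r.
have s2 (z : k) : s * (s * z) = - z - z by rewrite mulrA s_sqr mulNr mulr_natl mulr2n opprD.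
by apply: dual_eq8; rewrite !add_lfunE !opp_lfunE !mul_xE !mul_gE
  ?(mulNr, mulrN, opprK, x2, s2, mulr0, subrr, addNr).
Qed.

Lemma mul_gx phi : g ** (x ** phi) = - (x ** (g ** phi)).
Proof.
by apply: dual_eq8; rewrite !opp_lfunE !(mul_gE, mul_xE) ?(mulr0, oppr0, mulNr, mulrN, opprK)
  ?(mulrCA xi).
Qed.

(** The coefficients of spectral projections: 1 at m = 1, and 0 at the other fourth
    roots of unity. *)
Definition geom4 (m : k) : k := 4%:R^-1 * (1 + m + m ^+ 2 + m ^+ 3).

Lemma geom4E :
  ((geom4 1 = 1)%R * (geom4 (- 1) = 0)%R * (geom4 xi = 0)%R * (geom4 (- xi) = 0)%R)%type.
Proof.
have q0 m : m ^+ 2 = 1 -> geom4 m = 4%:R^-1 * ((1 + m) + (1 + m)).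
  by move=> m2; rewrite /geom4 (exprS m 2) m2 mulr1 -addrA.
have q1 m : m ^+ 2 = - 1 -> geom4 m = 0.
  by move=> m2; rewrite /geom4 (exprS m 2) m2 mulrN1 [1 + m - 1]addrAC subrr add0r subrr mulr0.
have xx : xi ^+ 2 = -1 := xi_sqr.
refine (_, _, _, _); rewrite ?(q1 xi) ?(q1 (- xi)) ?sqrrN //.
- by rewrite q0 ?expr1n // -[1 + 1]/(2%:R) -natrD mulVf.
- by rewrite q0 ?sqrrN ?expr1n // subrr addr0 mulr0.
Qed.

Lemma fourier_val t (h : K) m : (forall phi : dual H, (g ** phi) h = m * phi h) ->
  fourier gL t (eps : dual H) h = geom4 (t * m) * eps h.
Proof.
move=> gm; rewrite /fourier scale_lfunE !add_lfunE !scale_lfunE !gm.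
rewrite /geom4 -[LHS]/(_ * _) -[in RHS]mulrA; congr (_ * _).
rewrite -![_ *: _]/(_ * _) !mulrDl mul1r !exprMn.
by rewrite (exprS m 2) (expr2 m) !mulrA.
Qed.

Lemma fourierE t :
  [/\ fourier gL t (eps : dual H) 1 = geom4 t,
      fourier gL t (eps : dual H) a = geom4 (- (t * xi)),
      fourier gL t (eps : dual H) b = 0 & fourier gL t (eps : dual H) c = 0] /\
  [/\ fourier gL t (eps : dual H) d = geom4 (t * xi),
      fourier gL t (eps : dual H) (a ^+ 2) = geom4 (- t),
      fourier gL t (eps : dual H) (a * b) = 0 & fourier gL t (eps : dual H) (a * c) = 0].
Proof.
have [ea ed eb ec] := K_counit KP.
have m1 h phi : (g ** phi) h = phi h -> (g ** phi) h = 1 * phi h by rewrite mul1r.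
have mN1 h phi : (g ** phi) h = - phi h -> (g ** phi) h = -1 * phi h by rewrite mulN1r.
do 2!split.
- by rewrite (fourier_val t (m := 1)) ?(counit1 HP) ?mulr1 // => phi; apply/m1; rewrite mul_gE.
- by rewrite (fourier_val t (m := - xi)) ?ea ?mulr1 ?mulrN // => phi; rewrite mul_gE.
- by rewrite (fourier_val t (m := xi)) ?eb ?mulr0 // => phi; rewrite mul_gE.
- by rewrite (fourier_val t (m := - xi)) ?ec ?mulr0 // => phi; rewrite mul_gE.
- by rewrite (fourier_val t (m := xi)) ?ed ?mulr1 // => phi; rewrite mul_gE.
- rewrite (fourier_val t (m := -1)) ?expr2 ?(counitM HP) ?ea ?mulr1 ?mulrN1 // => phi.
  by apply/mN1; rewrite -expr2 mul_gE.
- rewrite (fourier_val t (m := 1)) ?(counitM HP) ?eb ?mulr0 // => phi.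
  by apply/m1; rewrite mul_gE.
- rewrite (fourier_val t (m := -1)) ?(counitM HP) ?ec ?mulr0 // => phi.
  by apply/mN1; rewrite mul_gE.
Qed.

(** Compared on the eight basis elements of K. *)
Lemma dual_expand phi : dual_action xL gL (eps : dual H) phi = phi.
Proof.
pose F t := fourier gL t (eps : dual H).
pose q : dual H := phi (a * c) *: F 1 + phi b *: F xi + phi c *: F (- xi) + phi (a * b) *: F (-1).
have qE h : q h =
    phi (a * c) * F 1 h + phi b * F xi h + phi c * F (- xi) h + phi (a * b) * F (-1) h.
  by rewrite !add_lfunE !scale_lfunE.
have actE h : dual_action xL gL (eps : dual H) phi h =
    phi 1 * F 1 h + phi a * F xi h + phi d * F (- xi) h + phi (a ^+ 2) * F (-1) h +
    s^-1 * (x ** q) h.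
  by rewrite /dual_action !add_lfunE !scale_lfunE.
have FE t : [/\ F t 1 = geom4 t, F t a = geom4 (- (t * xi)), F t b = 0 & F t c = 0] /\
  [/\ F t d = geom4 (t * xi), F t (a ^+ 2) = geom4 (- t), F t (a * b) = 0 & F t (a * c) = 0].
  exact: fourierE.
(* From here on only the values of the functionals matter. *)
set T := dual_action _ _ _ _ in actE *; clearbody T q F.
have [[p1 pa pb pc] [pd pa2 pab pac]] := FE 1.
have [[q1 qa qb qc] [qd qa2 qab qac]] := FE xi.
have [[r1 ra rb rc] [rd ra2 rab rac]] := FE (- xi).
have [[u1 ua ub uc] [ud ua2 uab uac]] := FE (-1).
have mulsV (z : k) : s^-1 * (s * z) = z by rewrite mulKf ?s_neq0.
apply: dual_eq8; split; rewrite actE mul_xE ?mulsV ?qE ?mulr0 ?addr0.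
all: rewrite ?(p1, q1, r1, u1) ?(pa, qa, ra, ua) ?(pb, qb, rb, ub) ?(pc, qc, rc, uc).
all: rewrite ?(pd, qd, rd, ud) ?(pa2, qa2, ra2, ua2) ?(pab, qab, rab, uab) ?(pac, qac, rac, uac).
all: by rewrite ?(mul1r, mulN1r, mulNr, mulrN, xi_sqr, opprK, geom4E, mulr0, mulr1, addr0, add0r).
Qed.

(** The dual of K is generated as an algebra by x and g. *)
Lemma dual_ind (P : dual H -> Prop) :
  (forall r f f', P f -> P f' -> P (r *: f + f')) ->
  P (eps : dual H) -> (forall f, P f -> P (x ** f)) -> (forall f, P f -> P (g ** f)) ->
  forall f, P f.
Proof.
move=> PL Pe Px Pg f; rewrite -(dual_expand f).
have PZ r h : P h -> P (r *: h).
  move=> Ph; have P0 : P 0 by rewrite -[0](addNr (eps : dual H)) -scaleN1r; apply: PL.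
  by rewrite -[_ *: _]addr0; apply: PL.
have PD h h' : P h -> P h' -> P (h + h') by move=> Ph Ph'; rewrite -[h]scale1r; apply: PL.
have PF t : P (fourier gL t (eps : dual H)).
  by rewrite /fourier; apply: (PZ); apply: (PD); [apply: (PD); [apply: (PD) => // |] |];
    apply: (PZ); do ?apply: (Pg).
by rewrite /dual_action; apply: (PD); [|apply: (PZ); apply: (Px)]; do 3?[apply: (PD)]; apply: (PZ).
Qed.

(** * The cross relations *)

Let Sinj := antipode_inj.
Notation A := (drinfeld_alg HP Sinj).
Notation iK := (of_K HP Sinj).
Notation iF := (of_dual HP Sinj).

Lemma lin_of_K (T : lmodType k) (f : T -> K) : linear f -> linear (fun w => iK (f w)).
Proof. by move=> lf r u v; rewrite lf linearP. Qed.

Lemma lin_of_dual (T : lmodType k) (f : T -> dual H) : linear f -> linear (fun w => iF (f w)).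
Proof. by move=> lf r u v; rewrite lf linearP. Qed.

Ltac lin_more ::= first
  [ apply: lin_translate1 | apply: lin_translate2 | apply: lin_translate3
  | apply: lin_dual_mull | apply: lin_dual_mulr | apply: lin_dual_comul
  | apply: lin_of_K | apply: lin_of_dual ].

Lemma translate_char (chi : dual H) u v : (forall h l, chi (h * l) = chi h * chi l :> k) ->
  translate u v chi = (chi u * chi v) *: chi.
Proof.
by move=> chiM; apply/lfunP => y; rewrite translateE scale_lfunE !chiM; exact: mulrAC.
Qed.

(** A functional del with Delta(del) = eps (x) del + del (x) chi; for x one takes
    chi = g. *)
Lemma translate_skew (chi del : dual H) u v :
  (forall h l, del (h * l) = eps h * del l + del h * chi l :> k) ->
  translate u v del =
    (eps u * del v) *: (eps : dual H) + (eps u * chi v) *: del + (del u * chi v) *: chi.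
Proof.
move=> delM; apply/lfunP => y; rewrite translateE !add_lfunE !scale_lfunE.
rewrite !delM (counitM HP) mulrDl addrA.
by congr (_ + _ + _); exact: mulrAC.
Qed.

(** The iterated coproduct of an entry of the matrix t = [a, b; c, d] is the sum of
    t_ip (x) t_pq (x) t_qj, so each exchange has four terms. *)
Lemma straighten_gens f (B := fun u v => iF (translate (S u) v f)) :
  [/\ iK a * iF f = B a a * iK a + B a c * iK b + (B b a * iK c + B b c * iK d),
      iK b * iF f = B a b * iK a + B a d * iK b + (B b b * iK c + B b d * iK d),
      iK c * iF f = B c a * iK a + B c c * iK b + (B d a * iK c + B d c * iK d) &
      iK d * iF f = B c b * iK a + B c d * iK b + (B d b * iK c + B d d * iK d)].
Proof.
have inner h1 := sw_comul_gens (F := fun h2 h3 => iF (translate (S h1) h3 f) * iK h2).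
have [||oa ob oc od] := sw_comul_gens
  (F := fun h1 h' => \sw_(h2, h3 <- D h') (iF (translate (S h1) h3 f) * iK h2)); [by multilin..|].
rewrite !of_K_of_dual oa ob oc od.
have [||-> -> _ _] := inner a; [by multilin..|].
have [|| _ _ -> ->] := inner b; [by multilin..|].
have [||-> -> _ _] := inner c; [by multilin..|].
have [|| _ _ -> ->] := inner d; [by multilin..|].
by [].
Qed.

Lemma straighten_g :
  [/\ iK a * iF g = iF g * iK a, iK b * iF g = - (iF g * iK b),
      iK c * iF g = - (iF g * iK c) & iK d * iF g = iF g * iK d].
Proof.
have [Sa Sb Sc Sd] := K_antipode KP.
have [[g1 ga gb gc] [gd ga2 gab gac]] := phi_gE.
have [-> -> -> ->] := straighten_gens g.
have BE u v : iF (translate u v g) = (g u * g v) *: iF g.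
  rewrite translate_char ?linearZ // => h l.
  exact: (phi_mul h l).2.
have gSb : g (xi *: b) = 0 by rewrite linearZ /= gb scaler0.
have gSc : g (- (xi *: c)) = 0 by rewrite linearN linearZ /= gc scaler0 oppr0.
rewrite !BE Sa Sb Sc Sd gSb gSc ga gb gc gd.
by rewrite !(mul0r, mulr0, scale0r, addr0, add0r, mulrN, mulNr, xi_sqr, opprK, scale1r, scaleN1r).
Qed.

Lemma straighten_x :
  [/\ iK a * iF x + xi *: (iF x * iK a) = s *: (iK b + iF g * iK c),
      iK b * iF x - xi *: (iF x * iK b) = s *: (iK a - iF g * iK d),
      iK c * iF x + xi *: (iF x * iK c) = s *: (iK d - iF g * iK a) &
      iK d * iF x - xi *: (iF x * iK d) = s *: (iK c + iF g * iK b)].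
Proof.
have [Sa Sb Sc Sd] := K_antipode KP.
have [ea ed eb ec] := K_counit KP.
have [[g1 ga gb gc] [gd ga2 gab gac]] := phi_gE.
have [[x1 xa xb xc] [xd xa2 xab xac]] := phi_xE.
have xSb : x (xi *: b) = xi * s by rewrite linearZ /= xb.
have xSc : x (- (xi *: c)) = - (xi * s) by rewrite linearN linearZ /= xc.
have [-> -> -> ->] := straighten_gens x.
have lin3 r1 r2 r3 (f1 f2 f3 : dual H) :
    iF (r1 *: f1 + r2 *: f2 + r3 *: f3) = r1 *: iF f1 + r2 *: iF f2 + r3 *: iF f3.
  by rewrite !linearD !linearZ.
have BE u v : iF (translate (S u) v x) =
    (eps u * x v) *: (1 : A) + (eps u * g v) *: iF x + (x (S u) * g v) *: iF g.
  rewrite (translate_skew (chi := g)) ?lin3 ?(counit_antipode HP) // => h l.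
  exact: (phi_mul h l).1.
rewrite !BE Sa Sb Sc Sd xSb xSc ea eb ec ed ga gb gc gd xa xb xc xd.
rewrite !(mul0r, mulr0, mul1r, mulr1, scale0r, addr0, add0r).
have xsx : xi * s * xi = - s by rewrite mulrAC xi_sqr mulN1r.
rewrite !mulrN !mulNr !xsx !opprK; generalize s => z.
rewrite -!scalerAl !mul1r !scaleNr !scalerDr !scalerN; split.
- by rewrite addrC !addrA subrr add0r.
- by rewrite addrAC addrK.
- by rewrite -addrA [- _ + _ + _]addrAC addNr add0r addrC.
- by rewrite -addrA addrK addrC.
Qed.

(** * The universal property *)

Lemma K_relations_morph (B C : algType k) (f : {lrmorphism B -> C}) (p q r t : B) :
  K_relations xi [:: p; q; r; t] -> K_relations xi [:: f p; f q; f r; f t].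
Proof.
case=> [[pq pr rq qr] [rt qt pt pt1] [qq rr ppr p4]].
rewrite /K_relations -!rmorphXn -!rmorphM -!linearZ pq pr rq qr rt qt qq rr ppr p4.
by rewrite -pt pt1 rmorph0 rmorph1.
Qed.

Lemma drinfeld_relations_gens :
  drinfeld_relations xi sqrt2 [:: iK a; iK b; iK c; iK d; iF x; iF g].
Proof.
have mulF := of_dualM HP Sinj; have F1 := of_dual1 HP Sinj.
split.
- exact: (K_relations_morph (of_K HP Sinj : {lrmorphism K -> A}) (K_presented KP).1).
- split.
  + by rewrite !exprS expr0 -F1 -!mulF mul_gggg.
  + have := mul_xx (eps : dual H); rewrite !(dual_mulf1 HP) => e.
    by rewrite !expr2 -F1 -!mulF e linearB.
  + have := mul_gx (eps : dual H); rewrite !(dual_mulf1 HP) => e.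
    by rewrite -!mulF e linearN addNr.
- exact: straighten_x.
- have [ga gb gc gd] := straighten_g.
  by split.
Qed.

Section Universal.
Variables (B : algType k) (p q r t y z : B).
Hypothesis relB : drinfeld_relations xi sqrt2 [:: p; q; r; t; y; z].
Variable fK : {lrmorphism K -> B}.
Hypothesis fKE : [/\ fK a = p, fK b = q, fK c = r & fK d = t].

Let fKM u w : fK (u * w) = fK u * fK w. Proof. exact: rmorphM. Qed.

Let fKL : linear fK. Proof. exact: linearP. Qed.

Definition dual_lift : dual H -> B :=
  dual_action (fun u => y * u) (fun u => z * u) 1.

Lemma dual_lift_linear : linear dual_lift.
Proof. by apply: dual_action_linear; multilin. Qed.

Lemma dual_lift1 : dual_lift (eps : dual H) = 1.
Proof. by apply: dual_action_counit => //; multilin. Qed.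

Let z4 u : z * (z * (z * (z * u))) = u.
Proof. by have [_ [z4 _ _] _ _] := relB; rewrite !mulrA -!expr2 -exprSr -exprSr z4 mul1r. Qed.

Let yy u : y * (y * u) = z * (z * u) - u.
Proof. by have [_ [_ yy _] _ _] := relB; rewrite !mulrA -!expr2 yy mulrBl mul1r. Qed.

Let zy u : z * (y * u) = - (y * (z * u)).
Proof.
by have [_ [_ _ /eqP zy] _ _] := relB; rewrite addr_eq0 in zy; rewrite !mulrA (eqP zy) mulNr.
Qed.

Lemma dual_lift_g f : dual_lift (g ** f) = z * dual_lift f.
Proof. by apply: dual_action_g => //; multilin. Qed.

Lemma dual_lift_x f : dual_lift (x ** f) = y * dual_lift f.
Proof. by apply: dual_action_x => //; multilin. Qed.

Definition drinfeld_lift (u : A) : B := \sw_(f, h <- u) (dual_lift f * fK h).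

Lemma drinfeld_lift_linear : linear drinfeld_lift.
Proof. exact: tlift_linear. Qed.

Lemma drinfeld_liftE f h : drinfeld_lift (iF f * iK h) = dual_lift f * fK h.
Proof.
rewrite of_dual_of_K /drinfeld_lift sw_tens //.
- by move=> v r' f1 f2; rewrite dual_lift_linear mulrDl scalerAl.
- by move=> v r' h1 h2; rewrite linearP mulrDr scalerAr.
Qed.

Lemma drinfeld_lift_xg v :
  drinfeld_lift (iF x * v) = y * drinfeld_lift v /\ drinfeld_lift (iF g * v) = z * drinfeld_lift v.
Proof.
have lM := drinfeld_lift_linear.
move: v; apply: drinfeld_alg_ind => [r' u v [ux ug] [vx vg]|f h].
  by rewrite !mulrDr -!scalerAr !lM ux ug vx vg !mulrDr -!scalerAr.
by rewrite !mulrA -!of_dualM !drinfeld_liftE dual_lift_x dual_lift_g !mulrA.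
Qed.

(** By induction on the word in x and g that stands to the left in v. To move a
    generator of K past a letter, the same cross relation is used in the double and
    in B; all four generators are treated together because the relations mix them. *)
Lemma drinfeld_lift_gens v :
  [/\ drinfeld_lift (iK a * v) = p * drinfeld_lift v,
      drinfeld_lift (iK b * v) = q * drinfeld_lift v,
      drinfeld_lift (iK c * v) = r * drinfeld_lift v &
      drinfeld_lift (iK d * v) = t * drinfeld_lift v].
Proof.
have [KP1 KP2 KP3 KP4] := fKE.
have lM := drinfeld_lift_linear.
have MD u w : drinfeld_lift (u + w) = drinfeld_lift u + drinfeld_lift w.
  by have := lM 1 u w; rewrite !scale1r.
have MZ r' u : drinfeld_lift (r' *: u) = r' *: drinfeld_lift u by apply: linZ.
have MN u : drinfeld_lift (- u) = - drinfeld_lift u by rewrite -scaleN1r MZ scaleN1r.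
move: v; apply: drinfeld_alg_ind => [r' u v [ua ub uc ud] [va vb vc vd]|f h].
  by rewrite !mulrDr -!scalerAr !lM ua ub uc ud va vb vc vd !mulrDr -!scalerAr.
pose P f := let v := iF f * iK h in
  [/\ drinfeld_lift (iK a * v) = p * drinfeld_lift v,
      drinfeld_lift (iK b * v) = q * drinfeld_lift v,
      drinfeld_lift (iK c * v) = r * drinfeld_lift v &
      drinfeld_lift (iK d * v) = t * drinfeld_lift v].
apply: (dual_ind (P := P)) => {f} [r' f f'||f|f]; rewrite /P.
- move=> [ua ub uc ud] [va vb vc vd].
  rewrite linearP mulrDl -scalerAl.
  by rewrite !mulrDr -!scalerAr !lM ua ub uc ud va vb vc vd !mulrDr -!scalerAr.
- have one w : drinfeld_lift (iK w) = fK w.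
    by rewrite -[iK w]mul1r -(of_dual1 HP Sinj) drinfeld_liftE dual_lift1 mul1r.
  by rewrite (of_dual1 HP Sinj) mul1r -!rmorphM !one !fKM KP1 KP2 KP3 KP4.
- rewrite of_dualM -!mulrA; set v := iF f * iK h => - [va vb vc vd].
  have [xa xb xc xd] := straighten_x.
  have [_ _ [ya yb yc yd] _] := relB.
  have Xv w := (drinfeld_lift_xg w).1; have Gv w := (drinfeld_lift_xg w).2.
  rewrite !Xv !mulrA.
  rewrite -[iK a * iF x](addrK (xi *: (iF x * iK a))) xa.
  rewrite -[iK b * iF x](subrK (xi *: (iF x * iK b))) xb.
  rewrite -[iK c * iF x](addrK (xi *: (iF x * iK c))) xc.
  rewrite -[iK d * iF x](subrK (xi *: (iF x * iK d))) xd.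
  rewrite -[p * y](addrK (xi *: (y * p))) ya -[q * y](subrK (xi *: (y * q))) yb.
  rewrite -[r * y](addrK (xi *: (y * r))) yc -[t * y](subrK (xi *: (y * t))) yd.
  rewrite !(mulrDl, mulNr) -!scalerAl !(mulrDl, mulNr) -!mulrA.
  rewrite !(MD, MZ, MN, Xv, Gv, va, vb, vc, vd).
  by split.
- rewrite of_dualM -!mulrA; set v := iF f * iK h => - [va vb vc vd].
  have [ga gb gc gd] := straighten_g.
  have [_ _ _ [za zb zc zd]] := relB.
  have Gv w := (drinfeld_lift_xg w).2.
  rewrite !Gv !mulrA ga gb gc gd za zb zc zd !mulNr -!mulrA.
  by rewrite !(MN, Gv, va, vb, vc, vd); split.
Qed.

Lemma drinfeld_lift_K h v : drinfeld_lift (iK h * v) = fK h * drinfeld_lift v.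
Proof.
have [KP1 KP2 KP3 KP4] := fKE.
move: h v; apply: K_ind.
- by move=> r' u w Pu Pw v; rewrite fKL linearP !mulrDl -!scalerAl drinfeld_lift_linear Pu Pw.
- by move=> v; rewrite !rmorph1 !mul1r.
- by move=> v; rewrite KP1; have [] := drinfeld_lift_gens v.
- by move=> v; rewrite KP2; have [] := drinfeld_lift_gens v.
- by move=> v; rewrite KP3; have [] := drinfeld_lift_gens v.
- by move=> v; rewrite KP4; have [] := drinfeld_lift_gens v.
- by move=> u w Pu Pw v; rewrite fKM rmorphM -!mulrA Pu Pw.
Qed.

Lemma drinfeld_lift_dual f v : drinfeld_lift (iF f * v) = dual_lift f * drinfeld_lift v.
Proof.
move: f v; apply: dual_ind.
- by move=> r' u w Pu Pw v; rewrite linearP mulrDl -scalerAl drinfeld_lift_linear Pu Pw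
      dual_lift_linear [RHS]mulrDl -[in RHS]scalerAl.
- by move=> v; rewrite (of_dual1 HP Sinj) dual_lift1 !mul1r.
- by move=> f Pf v; rewrite of_dualM dual_lift_x -!mulrA (drinfeld_lift_xg _).1 Pf.
- by move=> f Pf v; rewrite of_dualM dual_lift_g -!mulrA (drinfeld_lift_xg _).2 Pf.
Qed.

Lemma drinfeld_lift_morph : monoid_morphism drinfeld_lift.
Proof.
split=> [|u v].
  have -> : (1 : A) = iF (eps : dual H) * iK 1 by rewrite of_dual1 rmorph1 mulr1.
  by rewrite drinfeld_liftE dual_lift1 rmorph1 mulr1.
move: u; apply: drinfeld_alg_ind => [r' u w Pu Pw|f h].
  by rewrite mulrDl -scalerAl !drinfeld_lift_linear Pu Pw mulrDl scalerAl.
by rewrite -mulrA drinfeld_lift_dual drinfeld_lift_K drinfeld_liftE mulrA.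
Qed.

Lemma map_drinfeld_lift :
  map drinfeld_lift [:: iK a; iK b; iK c; iK d; iF x; iF g] = [:: p; q; r; t; y; z].
Proof.
have [KP1 KP2 KP3 KP4] := fKE.
have K1 h : drinfeld_lift (iK h) = fK h.
  by rewrite -[iK h]mulr1 drinfeld_lift_K drinfeld_lift_morph.1 mulr1.
have F1 f : drinfeld_lift (iF f) = dual_lift f.
  by rewrite -[iF f]mulr1 drinfeld_lift_dual drinfeld_lift_morph.1 mulr1.
rewrite /= !K1 !F1 KP1 KP2 KP3 KP4.
rewrite -[x](dual_mulf1 HP) -[g](dual_mulf1 HP).
by rewrite dual_lift_x dual_lift_g dual_lift1 !mulr1.
Qed.

End Universal.

(** The six elements generate the double. *)
Lemma eq_on_drinfeld_gens (B : algType k) (f f' : {lrmorphism A -> B}) :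
  map f [:: iK a; iK b; iK c; iK d; iF x; iF g] =
  map f' [:: iK a; iK b; iK c; iK d; iF x; iF g] -> f =1 f'.
Proof.
case=> fa fb fc fd fx fg.
have L (h : {lrmorphism A -> B}) : linear h by exact: linearP.
have M (h : {lrmorphism A -> B}) u w : h (u * w) = h u * h w by exact: rmorphM.
have one (h : {lrmorphism A -> B}) : h 1 = 1 by exact: rmorph1.
have fK h : f (iK h) = f' (iK h).
  move: h; apply: K_ind => //.
  - by move=> r' u w Pu Pw; rewrite linearP !L Pu Pw.
  - by rewrite rmorph1 !one.
  - by move=> u w Pu Pw; rewrite rmorphM !M Pu Pw.
have fF h : f (iF h) = f' (iF h).
  move: h; apply: dual_ind.
  - by move=> r' u w Pu Pw; rewrite linearP !L Pu Pw.
  - by rewrite of_dual1 !one.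
  - by move=> u Pu; rewrite of_dualM !M fx Pu.
  - by move=> u Pu; rewrite of_dualM !M fg Pu.
apply: drinfeld_alg_ind => [r' u w Pu Pw|h l]; first by rewrite !L Pu Pw.
by rewrite !M fK fF.
Qed.

End EightDimensional.

Theorem proposition2p5 (k : closedFieldType) (char0 : [pchar k] =i pred0)
    (xi : k) (xi_prim : 4.-primitive_root xi)
    (sqrt2 : k) (sqrt2E : sqrt2 ^+ 2 = 2%:R)
    (K : hopfData k) (a b c d : K) (KP : is_K xi a b c d) :
  let H := cop K in
  let inH (h : K) : drinfeld H := bowtie (counit H) (h : H) in
  let inHdual (f : dual K) : drinfeld H := bowtie (f : dual H) 1 in
  presented_as (drinfeld_relations xi sqrt2) (@drinfeld_mul k H) (drinfeld_one H)
    [:: inH a; inH b; inH c; inH d;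
        inHdual (phi_x xi sqrt2 a b c d); inHdual (phi_g xi a b c d)].
Proof.
move=> H inH inHdual.
have four_neq0 : 4%:R != 0 :> k by rewrite ((pcharf0P k).1 char0).
pose HP := K_hopf KP; pose Sinj := antipode_inj xi_prim KP.
pose A : algType k := drinfeld_alg HP Sinj.
pose id_lin := GRing.isLinear.Build k A (drinfeld H) _ (fun u : A => u : drinfeld H)
  (fun r u v => erefl).
pose phi : {linear A -> drinfeld H} := HB.pack (fun u : A => u : drinfeld H) id_lin.
pose gens : seq A := [:: of_K HP Sinj a; of_K HP Sinj b; of_K HP Sinj c; of_K HP Sinj d;
  of_dual HP Sinj (phi_x xi sqrt2 a b c d); of_dual HP Sinj (phi_g xi a b c d)].
exists A, phi, gens; split=> //; first by exists id.
split; first exact: drinfeld_relations_gens.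
move=> B ts relB.
case: ts relB => // p [//|q] [//|r] [//|t] [//|y] [//|z] [|//] relB.
have [relK _ _ _] := relB.
have [fK [KP1 KP2 KP3 KP4] _] := (K_presented KP).2 B _ relK.
have fKE : [/\ fK a = p, fK b = q, fK c = r & fK d = t] by [].
have fE := map_drinfeld_lift xi_prim sqrt2E KP four_neq0 relB fKE.
pose f0 : A -> B := drinfeld_lift sqrt2 y z fK.
pose f_lin := GRing.isLinear.Build k A B _ f0 (drinfeld_lift_linear sqrt2 y z fK).
pose f_mor := GRing.isMonoidMorphism.Build A B f0
  (drinfeld_lift_morph xi_prim sqrt2E KP four_neq0 relB fKE).
pose f : {lrmorphism A -> B} := HB.pack f0 f_lin f_mor.
exists f; first exact: fE.
move=> f' f'E; apply: (eq_on_drinfeld_gens sqrt2E four_neq0).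
by rewrite -/gens f'E -fE.
Qed.
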